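(* There exist absolute constants $c_3,c_4>0$ such that for $\eta\in[0,1/2)$, $\gamma=\tfrac12-\eta$, $\delta\in(0,1)$, $r\le\frac{\gamma}{c_3\sqrt d}$ and $N\ge \frac{c_4}{(r/2)^d\gamma^2}\ln\left(\frac{1}{r^d\gamma\delta}\right)$, in random-order best-response dynamics, with probability at least $1-\delta$ every sensor $i$ with $|w\cdot x_i|>2r$ updates correctly, i.e. its state after its update equals $t(x_i)$.
   Context: Sensors $1,\dots,N$ have positions $x_1,\dots,x_N$ drawn i.i.d. uniformly from the unit ball $\{x\in\mathbb{R}^d:\|x\|\le 1\}$, $d\ge1$. The target separator is the hyperplane $\{x: w\cdot x=0\}$ for a fixed unit vector $w$, and the target label of $x$ is $t(x)=\mathrm{sign}(w\cdot x)$. Noise rate $\eta$: conditional on the positions, the initial states in $\{+1,-1\}$ are independent across sensors, and sensor $i$'s initial state equals $t(x_i)$ with probability at least $1-\eta$. Distinct sensors $i\ne j$ are neighbors if $\|x_i-x_j\|\le r$. A best-response update of sensor $i$ sets its state to the majority state among its neighbors' current states (ties or no neighbors: arbitrary new state). Random-order best-response dynamics: a permutation $\pi$ of the sensors is drawn uniformly at random, independently of positions and states, and sensors $\pi(1),\dots,\pi(N)$ each perform one best-response update, one at a time, each using the states current at the time of its update. *)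

(* Defs.v *)
From HB Require Import structures.
From mathcomp Require Import all_boot all_order all_algebra all_fingroup.
From mathcomp Require Import all_classical all_reals all_analysis.
Set Implicit Arguments. Unset Strict Implicit. Unset Printing Implicit Defensive.
Import Order.TTheory GRing.Theory Num.Theory.
Local Open Scope ring_scope.

Section Defs.
Variable R : realType.

Definition dotp (d : nat) (u v : 'I_d -> R) : R := \sum_(k < d) u k * v k.
Definition norm2 (d : nat) (u : 'I_d -> R) : R := Num.sqrt (dotp u u).
Definition dist2 (d : nat) (u v : 'I_d -> R) : R := norm2 (fun k => u k - v k).

Definition ball_ind (d : nat) (y : 'I_d -> R) : R :=
  if norm2 y <= 1 then 1 else 0.

Definition ocons (T : Type) (n : nat) (t : T) (v : 'I_n -> T) : 'I_n.+1 -> T :=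
  fun i => match unlift ord0 i with Some j => v j | None => t end.

Fixpoint rint (n : nat) : (('I_n -> R) -> \bar R) -> \bar R :=
  match n with
  | 0 => fun F => F (fun _ => 0)
  | m.+1 => fun F =>
      (\int[@lebesgue_measure R]_(t in setT) @rint m (fun v => F (ocons (t : R) v)))%E
  end.

Fixpoint pint (d n : nat) : (('I_n -> 'I_d -> R) -> \bar R) -> \bar R :=
  match n with
  | 0 => fun F => F (fun _ _ => 0)
  | m.+1 => fun F => rint (fun y => @pint d m (fun v => F (ocons y v)))
  end.

Definition ball_vol (d : nat) : \bar R := rint (fun y : 'I_d -> R => (ball_ind y)%:E).

Definition unif_ball_expect (d N : nat) (F : ('I_N -> 'I_d -> R) -> R) : \bar R :=
  (((fine (ball_vol d)) ^- N)%:E *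
    pint (fun x => ((\prod_(i < N) ball_ind (x i)) * F x)%:E))%E.

(* States: true = +1, false = -1. *)
(* target label t(x) = sign(w.x); convention: +1 on the hyperplane (null set) *)
Definition target (d : nat) (w x : 'I_d -> R) : bool := 0 <= dotp w x.

Definition neighbor (d N : nat) (r : R) (x : 'I_N -> 'I_d -> R) (i j : 'I_N) : bool :=
  (i != j) && (dist2 (x i) (x j) <= r).

(* best response of sensor i to state vector s; [tie] is the (arbitrary)
   new state used in case of a tie (including no neighbours) *)
Definition best_response (d N : nat) (r : R) (x : 'I_N -> 'I_d -> R)
    (s : 'I_N -> bool) (i : 'I_N) (tie : bool) : bool :=
  let plus := #|[set j | neighbor r x i j & s j]| in
  let minus := #|[set j | neighbor r x i j & ~~ s j]| in
  if (minus < plus)%N then true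
  else if (plus < minus)%N then false
  else tie.

(* Tie-breaking rule: an arbitrary function of everything
   (positions, initial states, permutation, step index). *)
Definition tie_rule (d N : nat) :=
  ('I_N -> 'I_d -> R) -> {ffun 'I_N -> bool} -> {perm 'I_N} -> nat -> bool.

(* states after the first k updates of the random-order dynamics:
   at step k (0-based) sensor pi k updates *)
Fixpoint run (d N : nat) (r : R) (x : 'I_N -> 'I_d -> R) (s0 : {ffun 'I_N -> bool})
    (pi : {perm 'I_N}) (tb : tie_rule d N) (k : nat) : 'I_N -> bool :=
  match k with
  | 0 => fun i => s0 i
  | k'.+1 =>
      let s := run r x s0 pi tb k' in
      match (insub k' : option 'I_N) with
      | Some kk =>
          fun i => if i == pi kk then best_response r x s i (tb x s0 pi k') else s i
      | None => s
      end
  end.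

Definition good_event (d N : nat) (w : 'I_d -> R) (r : R) (x : 'I_N -> 'I_d -> R)
    (s0 : {ffun 'I_N -> bool}) (pi : {perm 'I_N}) (tb : tie_rule d N) : bool :=
  [forall k : 'I_N,
     (2 * r < `|dotp w (x (pi k))|) ==>
     (run r x s0 pi tb k.+1 (pi k) == target w (x (pi k)))].

(* Conditional probability of the good event given the positions x:
   initial states independent, sensor i correct with probability
   1 - q x i (q x i in [0, eta]); permutation uniform over 'S_N. *)
Definition cond_prob_good (d N : nat) (w : 'I_d -> R) (r : R)
    (q : ('I_N -> 'I_d -> R) -> 'I_N -> R) (tb : tie_rule d N)
    (x : 'I_N -> 'I_d -> R) : R :=
  \sum_(s0 : {ffun 'I_N -> bool})
     (\prod_(i < N) (if s0 i == target w (x i) then 1 - q x i else q x i)) *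
     ((\sum_(pi : {perm 'I_N}) (good_event w r x s0 pi tb)%:R) / (N`!)%:R).

Definition prob_good (d N : nat) (w : 'I_d -> R) (r : R)
    (q : ('I_N -> 'I_d -> R) -> 'I_N -> R) (tb : tie_rule d N) : \bar R :=
  unif_ball_expect (cond_prob_good w r q tb).

End Defs.

(* Main.v *)
Require Import Defs.
From HB Require Import structures.
From mathcomp Require Import all_boot all_order all_algebra all_fingroup.
From mathcomp Require Import all_classical all_reals all_analysis.
From mathcomp Require Import measurable_realfun measurable_fun_approximation.
From mathcomp Require Import lebesgue_integral_fubini.
From mathcomp Require Import ring lra zify.
Set Implicit Arguments. Unset Strict Implicit. Unset Printing Implicit Defensive.
Import Order.TTheory GRing.Theory Num.Theory.
Import numFieldNormedType.Exports.
Local Open Scope ring_scope.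

(* The positions are i.i.d. and independent of the permutation pi, so pi can be
   fixed throughout. Write z = w.x and let K be about 3N/4. Before step
   K, a sensor with |z| > r sees neighbours that all share its target; those
   already updated are correct, by induction on time, unless they lie in the slab
   |z| <= r. The slab takes at most half of the neighbourhood, up to a relative
   error O(r sqrt d) = O(gamma), while each of the remaining quarter of the sensors
   that have not been updated contributes a bias 2 gamma; hence such sensors update
   correctly. After step K, a sensor with |z| > 2r has no neighbour in the slab and
   about 3/4 of its neighbours were updated correctly before step K. Given the
   position of the updating sensor the other ones are independent, so both counts
   are controlled by exponential moments, whose integrals over the positions
   factorize; a union bound over the N steps concludes.

   That the slab takes about half of the neighbourhood y + rB of a point y with
   r < w.y <= 2r follows from the reflection in the hyperplane w.u = w.y: it sends
   the part of the neighbourhood below that hyperplane to the part above, up to a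
   shell 1 < |u| <= 1 + O(r^2), and a shell inside y + rB has relative volume
   O(r sqrt d). *)

(** * Iterated integrals *)

(** The integral of a nonnegative function is a supremum over the simple functions below it, and a
    larger function has more of them. The final integrand depends on arbitrary [q] and [tb], so it
    may fail to be measurable. *)
Lemma ge0_le_integral_nonmeas d (T : measurableType d) (R : realType)
    (mu : {measure set T -> \bar R}) (f g : T -> \bar R) :
  (forall x, 0 <= f x)%E -> (forall x, f x <= g x)%E ->
  (\int[mu]_x f x <= \int[mu]_x g x)%E.
Proof.
move=> f0 fg.
have g0 x : (0 <= g x)%E by exact: le_trans (fg x).
rewrite !ge0_integralTE//; apply: ge_ereal_sup => _ [h /= hf <-].
by apply: ereal_sup_ubound; exists h => // x; exact: le_trans (fg x).
Qed.

(* A plot of X is a map into X from a measurable space that is declared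
   measurable; functions out of X are then tested against plots, so that no
   sigma-algebra on spaces of vectors is needed. *)
Definition plots (X : Type) :=
  forall d (Z : measurableType d), (Z -> X) -> Prop.

Definition meas_on (R : realType) X (P : plots X) (F : X -> \bar R) : Prop :=
  forall d (Z : measurableType d) (b : Z -> X), P d Z b ->
    measurable_fun setT (fun z => F (b z) : \bar R).

Definition meas2 (R : realType) X Y (P : plots X) (Q : plots Y)
    (F : X -> Y -> \bar R) : Prop :=
  forall d (Z : measurableType d) (a : Z -> X) (b : Z -> Y),
    P d Z a -> Q d Z b -> measurable_fun setT (fun z => F (a z) (b z) : \bar R).

Definition mplots d (Y : measurableType d) : plots Y :=
  fun d' (Z : measurableType d') (a : Z -> Y) => measurable_fun setT a.

Definition vplots n X (P : plots X) : plots ('I_n -> X) :=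
  fun d (Z : measurableType d) (b : Z -> 'I_n -> X) =>
    forall j, P d Z (fun z => b z j).

(** The properties of an integral that pass to iterated integrals. [iop_meas], measurability of an
    integral in a parameter, carries the induction on the number of coordinates; [iop_le] must hold
    for arbitrary nonnegative functions. *)
Record integral_op (R : realType) X (P : plots X) (I : (X -> \bar R) -> \bar R)
    : Prop := IntegralOp {
  plot_cst : forall d (Z : measurableType d) x, P d Z (fun=> x);
  plot_comp : forall d d' (Z : measurableType d) (Z' : measurableType d')
    (a : Z' -> Z) b, measurable_fun setT a -> P d Z b -> P d' Z' (b \o a);
  iop_ge0 : forall F, (forall x, 0 <= F x)%E -> (0 <= I F)%E;
  iop_le : forall F G, (forall x, 0 <= F x)%E -> (forall x, F x <= G x)%E ->
    (I F <= I G)%E;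
  iopD : forall F G, (forall x, 0 <= F x)%E -> (forall x, 0 <= G x)%E ->
    meas_on P F -> meas_on P G -> I (fun x => F x + G x)%E = (I F + I G)%E;
  iopZ : forall (c : R) F, 0 <= c -> (forall x, 0 <= F x)%E -> meas_on P F ->
    I (fun x => c%:E * F x)%E = (c%:E * I F)%E;
  iop_meas : forall d (Y : measurableType d) (F : Y -> X -> \bar R),
    (forall y x, 0 <= F y x)%E -> meas2 (@mplots d Y) P F ->
    measurable_fun setT (fun y => I (F y) : \bar R) }.

Lemma iop_sum (R : realType) X (P : plots X) (I : (X -> \bar R) -> \bar R)
    (J : Type) (s : seq J) (f : J -> X -> R) :
  integral_op P I -> (forall j x, 0 <= f j x) ->
  (forall j, meas_on P (fun x => (f j x)%:E)) ->
  I (fun x => (\sum_(j <- s) f j x)%:E) = (\sum_(j <- s) I (fun x => (f j x)%:E))%E.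
Proof.
move=> opI f0 mf; elim: s => [|j s IH].
  have -> : (fun x => (\sum_(j <- [::]) f j x)%:E) = (fun=> 0%:E * 0%:E)%E.
    by apply/funext => x; rewrite big_nil mul0e.
  by rewrite big_nil (iopZ opI) ?mul0e// => d Z b _; exact: measurable_cst.
rewrite big_cons -IH -(iopD opI)//.
- by congr I; apply/funext => x; rewrite big_cons EFinD.
- by move=> x; rewrite lee_fin.
- by move=> x; rewrite lee_fin sumr_ge0.
- move=> d Z b pb; apply/measurable_EFinP; apply: measurable_sum => k.
  by apply/measurable_EFinP; exact: mf.
Qed.

(** Tonelli's theorem as a property of two operators. *)
Definition iop_commute (R : realType) X Y (P : plots X) (Q : plots Y)
    (I : (X -> \bar R) -> \bar R) (J : (Y -> \bar R) -> \bar R) : Prop :=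
  forall F : X -> Y -> \bar R, (forall x y, 0 <= F x y)%E -> meas2 P Q F ->
    I (fun x => J (F x)) = J (fun y => I (F ^~ y)).

Lemma iop_commute_sym (R : realType) X Y (P : plots X) (Q : plots Y)
    (I : (X -> \bar R) -> \bar R) (J : (Y -> \bar R) -> \bar R) :
  iop_commute P Q I J -> iop_commute Q P J I.
Proof.
by move=> cIJ F F0 mF; rewrite -(cIJ (fun x y => F y x))// => d Z a b ? ?; exact: mF.
Qed.

Section leb.
Variable R : realType.
Notation leb := (fun F : R -> \bar R => (\int[@lebesgue_measure R]_t F t)%E).
Notation RP := (@mplots _ (measurableTypeR R)).

Lemma meas_on_leb (F : R -> \bar R) :
  meas_on RP F -> measurable_fun setT (F : measurableTypeR R -> \bar R).
Proof. by move=> mF; apply: (mF _ (measurableTypeR R) id); exact: measurable_id. Qed.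

Lemma integral_op_leb : integral_op RP leb.
Proof.
split.
- by move=> d Z x; exact: measurable_cst.
- by move=> d d' Z Z' a b ma mb; exact: measurableT_comp.
- by move=> F F0; exact: integral_ge0.
- by move=> F G F0 FG; exact: ge0_le_integral_nonmeas.
- by move=> F G F0 G0 /meas_on_leb mF /meas_on_leb mG; rewrite ge0_integralD.
- by move=> c F c0 F0 /meas_on_leb mF; rewrite ge0_integralZl_EFin.
- move=> d Y F F0 mF.
  have mG : measurable_fun setT (fun z : Y * measurableTypeR R => F z.1 z.2).
    apply: mF; [exact: measurable_fst|exact: measurable_snd].
  exact: (@measurable_fun_fubini_tonelli_F _ _ _ _ _ _ _ mG).
Qed.

Lemma commute_leb : iop_commute RP RP leb leb.
Proof.
move=> F F0 mF.
have mG : measurable_fun setT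
    (fun z : measurableTypeR R * measurableTypeR R => F z.1 z.2).
  apply: mF; [exact: measurable_fst|exact: measurable_snd].
exact: (@fubini_tonelli _ _ _ _ _ (@lebesgue_measure R) (@lebesgue_measure R) _ mG).
Qed.

End leb.

Section iter.
Variables (R : realType) (X : Type) (P : plots X) (I : (X -> \bar R) -> \bar R).
Variable x0 : X.
Hypothesis opI : integral_op P I.

(** Common form of [rint] (over reals) and [pint] (over vectors), so that both inherit the same
    lemmas. *)
Fixpoint iter_op (n : nat) : (('I_n -> X) -> \bar R) -> \bar R :=
  match n with
  | 0 => fun F => F (fun=> x0)
  | m.+1 => fun F => I (fun x => iter_op (fun v => F (ocons x v)))
  end.

Definition oinsert n (i : 'I_n.+1) (x : X) (v : 'I_n -> X) : 'I_n.+1 -> X :=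
  fun j => match unlift i j with Some j' => v j' | None => x end.

Lemma oinsert_at n (i : 'I_n.+1) x v : oinsert i x v i = x.
Proof. by rewrite /oinsert unlift_none. Qed.

Lemma oinsert_lift n (i : 'I_n.+1) x v j : oinsert i x v (lift i j) = v j.
Proof. by rewrite /oinsert liftK. Qed.

Lemma ocons_oinsert n (i : 'I_n.+1) x y (v : 'I_n -> X) :
  ocons x (oinsert i y v) = oinsert (lift ord0 i) y (ocons x v).
Proof.
apply/funext => j; case: (unliftP (lift ord0 i) j) => [j'|] -> //.
  rewrite oinsert_lift; case: (unliftP ord0 j') => [k|] ->.
    rewrite [RHS]/ocons liftK.
    have -> : lift (lift ord0 i) (lift ord0 k) = lift ord0 (lift i k).
      by apply: val_inj; rewrite /= /bump !leq0n /= !add1n ltnS addnS.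
    by rewrite /ocons liftK oinsert_lift.
  have -> : lift (lift ord0 i) ord0 = ord0 :> 'I_n.+2.
    by apply: val_inj; rewrite /= /bump.
  by rewrite /ocons !unlift_none.
by rewrite oinsert_at /ocons liftK oinsert_at.
Qed.

Lemma plot_oinsert n d (Z : measurableType d) (i : 'I_n.+1) (a : Z -> X)
    (b : Z -> 'I_n -> X) : P a -> vplots P b ->
  vplots P (fun z => oinsert i (a z) (b z)).
Proof.
move=> pa pb j; case: (unliftP i j) => [k|] ->.
  by under eq_fun do rewrite oinsert_lift; exact: pb.
by under eq_fun do rewrite oinsert_at; exact: pa.
Qed.

Lemma iter_ge0 n (F : ('I_n -> X) -> \bar R) :
  (forall v, 0 <= F v)%E -> (0 <= iter_op F)%E.
Proof.
elim: n F => [|n IH] F F0 /=; first exact: F0.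
by apply: (iop_ge0 opI) => x; exact: IH.
Qed.

Lemma iter_le n (F G : ('I_n -> X) -> \bar R) :
  (forall v, 0 <= F v)%E -> (forall v, F v <= G v)%E ->
  (iter_op F <= iter_op G)%E.
Proof.
elim: n F G => [|n IH] F G F0 FG /=; first exact: FG.
apply: (iop_le opI) => x; first by apply: iter_ge0 => v; exact: F0.
by apply: IH => v.
Qed.

Lemma meas2_iter_step n d (Y : measurableType d)
    (F : Y -> ('I_n.+1 -> X) -> \bar R) (i : 'I_n.+1) :
  meas2 (@mplots d Y) (vplots P) F ->
  forall d' (Z : measurableType d') (a : Z -> Y) (b : Z -> X),
  measurable_fun setT a -> P b ->
  meas2 (@mplots d' Z) (vplots P) (fun z v => F (a z) (oinsert i (b z) v)).
Proof.
move=> mF d' Z a b ma pb d2 Z2 a2 b2 ma2 pb2.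
apply: mF; first exact: measurableT_comp.
by apply: plot_oinsert => //; exact: (plot_comp opI ma2 pb).
Qed.

Lemma iter_meas n d (Y : measurableType d) (F : Y -> ('I_n -> X) -> \bar R) :
  (forall y v, 0 <= F y v)%E -> meas2 (@mplots d Y) (vplots P) F ->
  measurable_fun setT (fun y => iter_op (F y) : \bar R).
Proof.
elim: n d Y F => [|n IH] d Y F F0 mF.
  by apply: (mF d Y id (fun=> fun=> x0)); [exact: measurable_id|case].
(* The coordinate just integrated joins the parameter: the induction hypothesis is applied with the
   test space [Z] in place of [Y]. *)
apply: (iop_meas opI) => [y x|d' Z a b ma pb]; first exact: iter_ge0.
apply: (IH d' Z (fun z v => F (a z) (ocons (b z) v))) => //.
exact: (meas2_iter_step ord0 mF ma pb).
Qed.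

Lemma meas_on_step n (F : ('I_n.+1 -> X) -> \bar R) (i : 'I_n.+1) :
  (forall v, 0 <= F v)%E -> meas_on (vplots P) F ->
  meas_on P (fun x => iter_op (fun v => F (oinsert i x v))).
Proof.
move=> F0 mF d Z b pb; apply: iter_meas => // d' Z' a b' ma pb'.
by apply: mF; apply: plot_oinsert => //; exact: (plot_comp opI ma pb).
Qed.

Lemma meas_on_oinsert n (F : ('I_n.+1 -> X) -> \bar R) (i : 'I_n.+1) x :
  meas_on (vplots P) F -> meas_on (vplots P) (fun v => F (oinsert i x v)).
Proof.
by move=> mF d Z b pb; apply: mF; apply: plot_oinsert => //; exact: (plot_cst opI).
Qed.

Lemma iterD n (F G : ('I_n -> X) -> \bar R) :
  (forall v, 0 <= F v)%E -> (forall v, 0 <= G v)%E ->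
  meas_on (vplots P) F -> meas_on (vplots P) G ->
  iter_op (fun v => F v + G v)%E = (iter_op F + iter_op G)%E.
Proof.
elim: n F G => [//|n IH] F G F0 G0 mF mG /=.
rewrite -(iopD opI).
- congr I; apply/funext => x; rewrite IH//; exact: (@meas_on_oinsert _ _ ord0).
- by move=> x; exact: iter_ge0.
- by move=> x; exact: iter_ge0.
- exact: (meas_on_step ord0 F0 mF).
- exact: (meas_on_step ord0 G0 mG).
Qed.

Lemma iterZ n (c : R) (F : ('I_n -> X) -> \bar R) :
  0 <= c -> (forall v, 0 <= F v)%E -> meas_on (vplots P) F ->
  iter_op (fun v => c%:E * F v)%E = (c%:E * iter_op F)%E.
Proof.
move=> c0; elim: n F => [//|n IH] F F0 mF /=.
rewrite -(iopZ opI c0).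
- congr I; apply/funext => x; rewrite IH//; exact: (@meas_on_oinsert _ _ ord0).
- by move=> x; exact: iter_ge0.
- exact: (meas_on_step ord0 F0 mF).
Qed.

Lemma integral_op_iter n : integral_op (@vplots n X P) (@iter_op n).
Proof.
split.
- by move=> d Z v j; exact: (plot_cst opI).
- by move=> d d' Z Z' a b ma pb j; exact: (plot_comp opI ma (pb j)).
- by move=> F; exact: iter_ge0.
- by move=> F G; exact: iter_le.
- by move=> F G; exact: iterD.
- by move=> c F; exact: iterZ.
- by move=> d Y F; exact: iter_meas.
Qed.

Section comm.
Variables (Y : Type) (Q : plots Y) (J : (Y -> \bar R) -> \bar R).
Hypothesis opJ : integral_op Q J.
Hypothesis cIJ : iop_commute P Q I J.

Lemma commute_iter n : iop_commute (@vplots n X P) Q (@iter_op n) J.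
Proof.
elim: n => [//|n IH] F F0 mF /=.
transitivity (I (fun x => J (fun y => iter_op (fun v => F (ocons x v) y)))).
  congr I; apply/funext => x; apply: (IH (fun v => F (ocons x v))) => //.
  move=> d Z a b pa qb; apply: mF => //.
  by apply: (plot_oinsert ord0) => //; exact: (plot_cst opI).
apply: (cIJ (F := fun x y => iter_op (fun v => F (ocons x v) y))).
  by move=> x y; exact: iter_ge0.
move=> d Z a b pa qb; apply: iter_meas => // d' Z' a' b' ma' pb'.
apply: mF; last exact: (plot_comp opJ ma' qb).
apply: (plot_oinsert ord0) => //; exact: (plot_comp opI ma' pa).
Qed.
End comm.

Hypothesis cII : iop_commute P P I I.

(** Repeated Tonelli brings any coordinate outermost. It is used for a coordinate with [w k != 0]
    and for the position of the updating sensor. *)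
Lemma iter_front n (i : 'I_n.+1) (F : ('I_n.+1 -> X) -> \bar R) :
  (forall v, 0 <= F v)%E -> meas_on (vplots P) F ->
  iter_op F = I (fun x => iter_op (fun v => F (oinsert i x v))).
Proof.
elim: n i F => [|n IH] i F F0 mF.
  by rewrite (ord1 i).
case: (unliftP ord0 i) => [j|] -> //.
transitivity (I (fun x => I (fun y =>
    iter_op (fun v => F (ocons x (oinsert j y v)))))).
  rewrite [LHS]/=; congr I; apply/funext => x.
  apply: (IH j (fun v => F (ocons x v))) => //.
  exact: (@meas_on_oinsert _ _ ord0).
under eq_fun do under eq_fun do under eq_fun do rewrite ocons_oinsert.
rewrite (cII (F := fun x y =>
  iter_op (fun v => F (oinsert (lift ord0 j) y (ocons x v)))))//.
  by move=> x y; exact: iter_ge0.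
move=> d Z a b pa pb; apply: iter_meas => // d' Z' a' b' ma' pb'.
apply: mF; apply: plot_oinsert; first exact: (plot_comp opI ma' pb).
apply: (plot_oinsert ord0) => //; exact: (plot_comp opI ma' pa).
Qed.

Lemma meas_on_fine_prod n (f : 'I_n -> X -> R) :
  (forall j, meas_on P (fun x => (f j x)%:E)) ->
  meas_on (vplots P) (fun v => (\prod_j f j (v j))%:E).
Proof.
move=> mf d Z b pb; apply/measurable_EFinP.
under eq_fun do rewrite -big_enum /=.
apply: measurable_prod => j _; apply/measurable_EFinP.
by apply: mf; exact: pb.
Qed.

(** Independence of the coordinates. The factors [C j] are real, so constants can be pulled out of
    the integrals one by one. *)
Lemma iter_prod n (f : 'I_n -> X -> R) (C : 'I_n -> R) :
  (forall j x, 0 <= f j x) -> (forall j, meas_on P (fun x => (f j x)%:E)) ->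
  (forall j, I (fun x => (f j x)%:E) = (C j)%:E) ->
  iter_op (fun v => (\prod_j f j (v j))%:E) = (\prod_j C j)%:E.
Proof.
elim: n f C => [|n IH] f C f0 mf fC /=; first by rewrite !big_ord0.
have C0 j : 0 <= C j.
  by rewrite -lee_fin -fC; apply: (iop_ge0 opI) => x; rewrite lee_fin.
under eq_fun => x.
  under eq_fun => v.
    rewrite big_ord_recl EFinM {1}/ocons unlift_none.
    under eq_bigr do rewrite /ocons liftK.
    over.
  rewrite (iterZ (f0 _ x)); first last.
  - by apply: (meas_on_fine_prod (f := fun j => f (lift ord0 j))) => j; exact: mf.
  - by move=> v; rewrite lee_fin prodr_ge0.
  rewrite (IH (fun j => f (lift ord0 j)) (fun j => C (lift ord0 j)))//.
  rewrite muleC.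
  over.
rewrite (iopZ opI)//.
  by rewrite fC -EFinM big_ord_recl mulrC.
- by apply: prodr_ge0.
- by move=> x; rewrite lee_fin.
Qed.

End iter.

(** * Affine changes of variables and reflections *)

Section leb_affine.
Variable R : realType.
Notation leb := (@lebesgue_measure R).

Lemma preimage_affine (a b x y : R) : a != 0 ->
  leb ((fun t : R => a * t + b) @^-1` `]x, y]%classic) =
  ((`|a|^-1)%:E * leb `]x, y]%classic)%E.
Proof.
move=> a0.
have [a_gt0|a_lt0|] := ltgtP 0 a; last by move=> a00; rewrite -a00 eqxx in a0.
- have -> : ((fun t : R => a * t + b) @^-1` `]x, y]%classic =
      `](x - b) / a, (y - b) / a]%classic)%classic.
    apply/seteqP; split => t /=; rewrite !in_itv /= ltr_pdivrMr// ler_pdivlMr// mulrC;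
    by rewrite ltrBlDr lerBrDr.
  rewrite !lebesgue_measure_itv /= !lte_fin ltr_pM2r ?invr_gt0// ltrD2r.
  case: ifP => _; last by rewrite mule0.
  by rewrite -EFinB -EFinM gtr0_norm//; congr EFin; field; rewrite gt_eqF.
- have -> : ((fun t : R => a * t + b) @^-1` `]x, y]%classic =
      `[(y - b) / a, (x - b) / a[%classic)%classic.
    apply/seteqP; split => t /=; rewrite !in_itv /= ltr_ndivlMr// ler_ndivrMr// mulrC;
    by rewrite ltrBlDr lerBrDr andbC.
  rewrite !lebesgue_measure_itv /= !lte_fin ltr_nM2r ?invr_lt0// ltrD2r.
  case: ifP => _; last by rewrite mule0.
  by rewrite -EFinB -EFinM ltr0_norm//; congr EFin; field; rewrite lt_eqF.
Qed.

(** The image of Lebesgue measure under the affine map, scaled by [|a|], has the right value on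
    half-open intervals, hence is Lebesgue measure by uniqueness. *)
Lemma lebesgue_affine (a b : R) (F : R -> \bar R) : a != 0 ->
  (forall t, 0 <= F t)%E -> meas_on (@mplots _ (measurableTypeR R)) F ->
  (\int[leb]_t F (a * t + b)%R = (`|a|^-1)%:E * \int[leb]_t F t)%E.
Proof.
move=> a0 F0 /meas_on_leb mF.
pose phi : measurableTypeR R -> measurableTypeR R := fun t : R => a * t + b.
have mphi : measurable_fun setT phi.
  by apply: measurable_funD => //; apply: measurable_funM => //.
have an : 0 <= `|a| by [].
pose mu' : {measure set (measurableTypeR R) -> \bar R} :=
  mscale (NngNum an) (pushforward leb phi).
pose mu := mu' mphi.
have E : forall A : set (measurableTypeR R), measurable A -> leb A = mu A.
  apply: lebesgue_measure_unique => _ [[x y] _ <-].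
  change (leb `]x, y]%classic =
    (`|a|%:E * leb ((fun t : R => (a * t + b)%R) @^-1` `]x, y]%classic))%E).
  rewrite preimage_affine// muleA -EFinM divff ?mul1e//.
  by rewrite normr_eq0.
rewrite [in RHS](@eq_measure_integral _ _ _ _ mu)//; last by move=> A mA _; exact: E.
rewrite /mu /mu' ge0_integral_mscale// ge0_integral_pushforward//.
by rewrite muleA -EFinM mulVf ?normr_eq0// mul1e preimage_setT.
Qed.
End leb_affine.

Section vectors.
Variable R : realType.
Notation leb := (fun F : R -> \bar R => (\int[@lebesgue_measure R]_t F t)%E).
Notation RP := (@mplots _ (measurableTypeR R)).
Notation VP n := (@vplots n R RP).

Definition rmeas X (P : plots X) (f : X -> R) : Prop :=
  forall d (Z : measurableType d) (b : Z -> X), P d Z b ->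
    measurable_fun setT (fun z => f (b z) : measurableTypeR R).

Lemma rmeas_EFin X (P : plots X) (f : X -> R) :
  rmeas P f -> meas_on P (fun x => (f x)%:E).
Proof. by move=> mf d Z b pb; apply/measurable_EFinP; exact: mf. Qed.

Lemma rmeas_cst X (P : plots X) (c : R) : rmeas P (fun=> c).
Proof. by move=> d Z b pb; exact: measurable_cst. Qed.

Lemma rmeasD X (P : plots X) (f g : X -> R) :
  rmeas P f -> rmeas P g -> rmeas P (fun x => f x + g x).
Proof. by move=> mf mg d Z b pb; apply: measurable_funD; [exact: mf|exact: mg]. Qed.

Lemma rmeasM X (P : plots X) (f g : X -> R) :
  rmeas P f -> rmeas P g -> rmeas P (fun x => f x * g x).
Proof. by move=> mf mg d Z b pb; apply: measurable_funM; [exact: mf|exact: mg]. Qed.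

Lemma rmeasB X (P : plots X) (f g : X -> R) :
  rmeas P f -> rmeas P g -> rmeas P (fun x => f x - g x).
Proof. by move=> mf mg d Z b pb; apply: measurable_funB; [exact: mf|exact: mg]. Qed.

Lemma rmeasN X (P : plots X) (f : X -> R) : rmeas P f -> rmeas P (fun x => - f x).
Proof. by move=> mf d Z b pb; apply: measurableT_comp => //; exact: mf. Qed.

Lemma rmeas_sum X (P : plots X) n (f : 'I_n -> X -> R) :
  (forall j, rmeas P (f j)) -> rmeas P (fun x => \sum_j f j x).
Proof.
move=> mf d Z b pb.
under eq_fun do rewrite -big_enum /=.
by apply: measurable_sum => j; exact: mf.
Qed.

Lemma rmeas_prod X (P : plots X) n (f : 'I_n -> X -> R) :
  (forall j, rmeas P (f j)) -> rmeas P (fun x => \prod_j f j x).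
Proof.
move=> mf d Z b pb.
under eq_fun do rewrite -big_enum /=.
by apply: measurable_prod => j _; exact: mf.
Qed.

Lemma rmeas_if_le X (P : plots X) (f g h k : X -> R) :
  rmeas P f -> rmeas P g -> rmeas P h -> rmeas P k ->
  rmeas P (fun x => if f x <= g x then h x else k x).
Proof.
move=> mf mg mh mk d Z b pb; apply: measurable_fun_ifT.
- by apply: measurable_fun_ler; [exact: mf|exact: mg].
- exact: mh.
- exact: mk.
Qed.

Lemma meas_comp X n (P : plots X) (F : ('I_n -> R) -> \bar R) (phi : X -> 'I_n -> R) :
  (forall j, rmeas P (phi ^~ j)) -> meas_on (VP n) F -> meas_on P (F \o phi).
Proof. by move=> mphi mF d Z b pb; apply: mF => j; exact: mphi. Qed.

Lemma rmeas_coord n (j : 'I_n) : rmeas (VP n) (fun v => v j).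
Proof. by move=> d Z b pb; exact: pb. Qed.

Lemma rmeas_oinsert X (P : plots X) n (i : 'I_n.+1) (f : X -> R)
    (phi : X -> 'I_n -> R) :
  rmeas P f -> (forall j, rmeas P (phi ^~ j)) ->
  forall j, rmeas P (fun x => oinsert i (f x) (phi x) j).
Proof.
move=> mf mphi j d Z b pb; case: (unliftP i j) => [k|] ->.
  by under eq_fun do rewrite oinsert_lift; exact: mphi.
by under eq_fun do rewrite oinsert_at; exact: mf.
Qed.

Lemma rintE n : @rint R n = @iter_op R R leb 0 n.
Proof. by elim: n => [|n IH] //; apply/funext => F /=; rewrite IH. Qed.

Lemma iop_rint n : integral_op (VP n) (@rint R n).
Proof. by rewrite rintE; apply: integral_op_iter; exact: integral_op_leb. Qed.

Lemma commute_rint_leb n : iop_commute (VP n) RP (@rint R n) leb.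
Proof.
by rewrite rintE; apply: commute_iter;
  [exact: integral_op_leb|exact: integral_op_leb|exact: commute_leb].
Qed.

Lemma commute_rint m n : iop_commute (VP m) (VP n) (@rint R m) (@rint R n).
Proof.
rewrite (rintE m); apply: commute_iter;
  [exact: integral_op_leb|exact: iop_rint|].
by apply: iop_commute_sym; exact: commute_rint_leb.
Qed.

Lemma rint_front n (i : 'I_n.+1) (F : ('I_n.+1 -> R) -> \bar R) :
  (forall v, 0 <= F v)%E -> meas_on (VP _) F ->
  rint F = leb (fun t => rint (fun v => F (oinsert i t v))).
Proof.
rewrite !rintE => F0 mF.
by rewrite [LHS](@iter_front _ _ _ _ 0 (integral_op_leb R) (@commute_leb R) _ i).
Qed.

Lemma rint_affine n (a : R) (b : 'I_n -> R) (F : ('I_n -> R) -> \bar R) :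
  a != 0 -> (forall v, 0 <= F v)%E -> meas_on (VP n) F ->
  rint (fun v => F (fun j => a * v j + b j)) = ((`|a| ^- n)%:E * rint F)%E.
Proof.
move=> a0; elim: n b F => [|n IH] b F F0 mF /=.
  by rewrite expr0 invr1 mul1e; congr F; apply/funext; case.
transitivity (leb (fun t => (`|a| ^- n)%:E *
    rint (fun v => F (ocons (a * t + b ord0)%R v)))%E).
  congr integral; apply/funext => t.
  rewrite -(IH (fun j => b (lift ord0 j)) (fun v => F (ocons _ v)))//; last first.
    apply: (meas_comp (phi := fun v => ocons _ v)) mF.
    by apply: (rmeas_oinsert ord0) => [|j]; [exact: rmeas_cst|exact: rmeas_coord].
  congr rint; apply/funext => v; congr F; apply/funext => j.
  by case: (unliftP ord0 j) => [k|] ->; rewrite /ocons ?liftK ?unlift_none.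
have mG : meas_on RP (fun t => rint (fun v => F (ocons t v))).
  rewrite rintE; exact: (meas_on_step 0 (integral_op_leb R) ord0 F0 mF).
have G0 t : (0 <= rint (fun v => F (ocons t v)))%E by exact: (iop_ge0 (iop_rint n)).
rewrite (iopZ (integral_op_leb R))//.
  rewrite (lebesgue_affine (b ord0) (F := fun t => rint (fun v => F (ocons t v))) a0)//.
  by rewrite muleA -EFinM exprSr invfM.
move=> d Z c mc; apply: (mG _ _ (fun z => a * c z + b ord0)).
by apply: measurable_funD => //; apply: measurable_funM.
Qed.

(** Tonelli puts the integral over [t] innermost, where [s v] is a constant shift. This is the
    change of variables that replaces the coordinate k by w.v. *)
Lemma rint_shear n (k : 'I_n.+1) (c : R) (s : ('I_n -> R) -> R)
    (H : ('I_n.+1 -> R) -> \bar R) :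
  c != 0 -> rmeas (VP n) s -> (forall v, 0 <= H v)%E -> meas_on (VP _) H ->
  leb (fun t => rint (fun v => H (oinsert k (c * t + s v) v))) =
  ((`|c|^-1)%:E * rint H)%E.
Proof.
move=> c0 ms H0 mH.
transitivity (rint (fun v => leb (fun t => H (oinsert k (c * t + s v) v)))).
  symmetry.
  apply: (commute_rint_leb (F := fun v t => H (oinsert k (c * t + s v) v))) => //.
  move=> d Z a b pa mb; apply: mH; apply: plot_oinsert => //.
  apply: measurable_funD; last exact: ms.
  by apply: measurable_funM.
transitivity ((`|c|^-1)%:E *
    rint (fun v => leb (fun t => H (oinsert k t v))))%E; last first.
  congr (_ * _)%E; rewrite (rint_front k)//.
  apply: (commute_rint_leb (F := fun v t => H (oinsert k t v))) => //.
  by move=> d Z a b pa mb; apply: mH; apply: plot_oinsert.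
rewrite -(iopZ (iop_rint n))//.
- congr rint; apply/funext => v.
  rewrite (lebesgue_affine (s v) (F := fun t => H (oinsert k t v)))//.
  by move=> d Z b mb; apply: mH; apply: plot_oinsert => // j; exact: measurable_cst.
- by move=> v; exact: integral_ge0.
- move=> d Z b pb.
  apply: (iop_meas (integral_op_leb R) (F := fun z t => H (oinsert k t (b z)))) => //.
  move=> d' Z' a' b' ma' mb'; apply: mH; apply: plot_oinsert => // j.
  exact: measurableT_comp (pb j) ma'.
Qed.

Definition hreflect n (w v : 'I_n -> R) : 'I_n -> R :=
  fun j => v j - 2 * dotp w v * w j.

Lemma rmeas_dotp X (P : plots X) n (f g : X -> 'I_n -> R) :
  (forall j, rmeas P (f ^~ j)) -> (forall j, rmeas P (g ^~ j)) ->
  rmeas P (fun x => dotp (f x) (g x)).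
Proof. by move=> mf mg; apply: rmeas_sum => j; exact: rmeasM. Qed.

Lemma dotp_oinsert n (k : 'I_n.+1) (w : 'I_n.+1 -> R) t v :
  dotp w (oinsert k t v) = w k * t + dotp (fun j => w (lift k j)) v.
Proof.
rewrite /dotp (bigD1_ord k)//= oinsert_at; congr (_ + _).
by apply: eq_bigr => j _; rewrite oinsert_lift.
Qed.

(* In the coordinate w.v instead of v_k, where w_k <> 0, the reflection negates
   that coordinate and translates the others. *)
Lemma rint_reflect n (w : 'I_n -> R) (F : ('I_n -> R) -> \bar R) :
  dotp w w = 1 -> (forall v, 0 <= F v)%E -> meas_on (VP n) F ->
  rint (fun v => F (hreflect w v)) = rint F.
Proof.
case: n w F => [|n] w F w1 F0 mF.
  by rewrite /=; congr F; apply/funext; case.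
have [k wk0] : exists k, w k != 0.
  apply/existsP; rewrite -[X in is_true X]negbK negb_exists; apply/forallP => w0.
  have : dotp w w = 0.
    by rewrite /dotp big1// => i _; have /negPn/eqP -> := w0 i; rewrite mul0r.
  by rewrite w1 => /eqP; rewrite oner_eq0.
pose w' j := w (lift k j).
have wE : w = oinsert k (w k) w'.
  apply/funext => j; case: (unliftP k j) => [i|] ->;
  by rewrite ?oinsert_lift ?oinsert_at.
have w'1 : dotp w' w' = 1 - w k * w k.
  by move: w1; rewrite {2}wE dotp_oinsert => <-; rewrite addrAC subrr add0r.
have mdot : rmeas (VP n) (dotp w').
  by apply: rmeas_dotp => j; [exact: rmeas_cst|exact: rmeas_coord].
have mdot' : rmeas (VP n.+1) (fun u => dotp w' (fun j => u (lift k j))).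
  by apply: rmeas_dotp => j; [exact: rmeas_cst|exact: rmeas_coord].
(* [G] is [F] in the coordinates whose k-th entry is w.v: it recovers v_k from that entry. *)
pose G (u : 'I_n.+1 -> R) :=
  F (oinsert k ((u k - dotp w' (fun j => u (lift k j))) / w k) (fun j => u (lift k j))).
have mG : meas_on (VP _) G.
  apply: (meas_comp (phi := fun u : 'I_n.+1 -> R => oinsert k _ _)) mF.
  apply: rmeas_oinsert => [|j]; last exact: rmeas_coord.
  by apply: rmeasM; [apply: rmeasB => //; exact: rmeas_coord|exact: rmeas_cst].
have GE t v : G (oinsert k t v) = F (oinsert k ((t - dotp w' v) / w k) v).
  rewrite /G oinsert_at.
  by under [X in dotp w' X]eq_fun do rewrite oinsert_lift;
     under [X in oinsert _ _ X]eq_fun do rewrite oinsert_lift.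
(* [GQ] is the reflected function in the same coordinates. *)
pose GQ (u : 'I_n.+1 -> R) :=
  G (oinsert k (- u k) (fun j => u (lift k j) - 2 * u k * w' j)).
have mGQ : meas_on (VP _) GQ.
  apply: (meas_comp (phi := fun u : 'I_n.+1 -> R => oinsert k _ _)) mG.
  apply: rmeas_oinsert => [|j].
    by apply: rmeasN; exact: rmeas_coord.
  apply: rmeasB; first exact: rmeas_coord.
  by apply: rmeasM; [apply: rmeasM|]; try exact: rmeas_cst; exact: rmeas_coord.
have GQE t v : GQ (oinsert k t v) = G (oinsert k (- t) (fun j => v j - 2 * t * w' j)).
  rewrite /GQ oinsert_at; congr (G (oinsert _ _ _)).
  by apply/funext => j; rewrite oinsert_lift.
have FE t v : F (hreflect w (oinsert k t v)) = GQ (oinsert k (w k * t + dotp w' v) v).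
  rewrite GQE GE; congr F; apply/funext => j; rewrite /hreflect dotp_oinsert.
  case: (unliftP k j) => [i|] ->; rewrite ?oinsert_lift ?oinsert_at//.
  set D := dotp _ v; set tau := w k * t + D.
  have -> : dotp w' (fun j => v j - 2 * tau * w' j) = D - 2 * tau * (1 - w k * w k).
    rewrite -w'1 /D /dotp mulr_sumr -sumrB; apply: eq_bigr => i _; rewrite /w'; ring.
  by rewrite /tau; field.
have mFr : meas_on (VP n.+1) (fun v => F (hreflect w v)).
  apply: (meas_comp (phi := hreflect w)) mF => j.
  apply: rmeasB; first exact: rmeas_coord.
  apply: rmeasM; [apply: rmeasM|]; try exact: rmeas_cst.
  by apply: rmeas_dotp => i; [exact: rmeas_cst|exact: rmeas_coord].
rewrite (rint_front k)//.
under eq_fun do under eq_fun do rewrite FE.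
rewrite (rint_shear k wk0 mdot)//; last by move=> v; exact: F0.
transitivity ((`|w k|^-1)%:E * rint G)%E; last first.
  rewrite -(rint_shear k wk0 mdot)//; last by move=> v; exact: F0.
  rewrite (rint_front k)//; congr integral; apply/funext => t.
  congr rint; apply/funext => v; rewrite GE; congr (F (oinsert _ _ _)).
  by field.
congr (_ * _)%E; rewrite (rint_front k)//; last by move=> v; exact: F0.
rewrite [RHS](rint_front k)//; last by move=> v; exact: F0.
pose K t := rint (fun v => G (oinsert k t v)).
have mK : meas_on RP K.
  rewrite /K rintE; exact: (meas_on_step 0 (integral_op_leb R) k (fun v => F0 _) mG).
have K0 t : (0 <= K t)%E by apply: (iop_ge0 (iop_rint n)) => v; exact: F0.
transitivity (leb (fun t => K ((-1) * t + 0))).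
  congr integral; apply/funext => t.
  under eq_fun do rewrite GQE.
  rewrite /K mulN1r addr0.
  have -> : (fun v => G (oinsert k (- t) (fun j => v j - 2 * t * w' j))) =
    (fun v => (fun v => G (oinsert k (- t) v)) (fun j => 1 * v j + - (2 * t * w' j))).
    by apply/funext => v; congr (G (oinsert _ _ _)); apply/funext => j; rewrite mul1r.
  rewrite (rint_affine (fun j => - (2 * t * w' j))
    (F := fun v => G (oinsert k (- t) v)))//.
  - by rewrite normr1 expr1n invr1 mul1e.
  - by move=> v; exact: F0.
  - exact: (meas_on_oinsert (integral_op_leb R)).
by rewrite lebesgue_affine ?oppr_eq0 ?oner_neq0// normrN normr1 invr1 mul1e.
Qed.

End vectors.

(** * Volumes of neighbourhoods *)

Section geometry.
Variable R : realType.
Notation leb := (fun F : R -> \bar R => (\int[@lebesgue_measure R]_t F t)%E).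
Notation RP := (@mplots _ (measurableTypeR R)).
Notation VP n := (@vplots n R RP).

Section dotp.
Variable d : nat.
Implicit Types u v w y : 'I_d -> R.

Lemma dotpC u v : dotp u v = dotp v u.
Proof. by apply: eq_bigr => k _; rewrite mulrC. Qed.

Lemma dotpDr w u v : dotp w (fun k => u k + v k) = dotp w u + dotp w v.
Proof. by rewrite /dotp -big_split; apply: eq_bigr => k _; rewrite mulrDr. Qed.

Lemma dotpBr w u v : dotp w (fun k => u k - v k) = dotp w u - dotp w v.
Proof. by rewrite /dotp -sumrB; apply: eq_bigr => k _; rewrite mulrBr. Qed.

Lemma dotpZr w a u : dotp w (fun k => a * u k) = a * dotp w u.
Proof. by rewrite /dotp mulr_sumr; apply: eq_bigr => k _; rewrite mulrCA. Qed.

Lemma dotpDl w u v : dotp (fun k => u k + v k) w = dotp u w + dotp v w.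
Proof. by rewrite dotpC dotpDr !(dotpC w). Qed.

Lemma dotpBl w u v : dotp (fun k => u k - v k) w = dotp u w - dotp v w.
Proof. by rewrite dotpC dotpBr !(dotpC w). Qed.

Lemma dotpZl w a u : dotp (fun k => a * u k) w = a * dotp u w.
Proof. by rewrite dotpC dotpZr (dotpC w). Qed.

Definition dotpE := (dotpBr, dotpBl, dotpDr, dotpDl, dotpZr, dotpZl).

Lemma dotp_ge0 u : 0 <= dotp u u.
Proof. by apply: sumr_ge0 => k _; rewrite -expr2 sqr_ge0. Qed.

Lemma norm2_le u (a : R) : 0 <= a -> (norm2 u <= a) = (dotp u u <= a ^+ 2).
Proof.
by move=> a0; rewrite /norm2 -{1}(ger0_norm a0) -sqrtr_sqr ler_sqrt// sqr_ge0.
Qed.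

(** Cauchy-Schwarz, from the squared norm of v - (w.v) w. *)
Lemma dotp_unit_sqr w v : dotp w w = 1 -> dotp w v ^+ 2 <= dotp v v.
Proof.
move=> w1; have := dotp_ge0 (fun k => v k - dotp w v * w k).
rewrite !dotpE w1 (dotpC v w) expr2; set x := dotp w v; lra.
Qed.

(** Convexity of the unit ball, from t (1 - t) |u - v|^2 >= 0. *)
Lemma dotp_convex u v (t : R) : 0 <= t <= 1 ->
  dotp u u <= 1 -> dotp v v <= 1 ->
  dotp (fun k => t * u k + (1 - t) * v k) (fun k => t * u k + (1 - t) * v k) <= 1.
Proof.
move=> /andP[t0 t1] u1 v1.
have := dotp_ge0 (fun k => u k - v k); rewrite !dotpE (dotpC v u).
set x := dotp u u in u1 *; set y := dotp v v in v1 *; set z := dotp u v => H.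
have : 0 <= t * (1 - t) * (x - z - (z - y)) by rewrite !mulr_ge0// subr_ge0.
have : t * x <= t * 1 by rewrite ler_wpM2l.
have : (1 - t) * y <= (1 - t) * 1 by rewrite ler_wpM2l// subr_ge0.
nra.
Qed.

End dotp.

Lemma bernoulli_inequality (x : R) n : 0 <= x <= 1 -> 1 - n%:R * x <= (1 - x) ^+ n.
Proof.
move=> /andP[x0 x1]; elim: n => [|n IH]; first by rewrite mul0r subr0 expr0.
rewrite exprS; have [h|h] := leP (n%:R * x) 1; last first.
  apply: (@le_trans _ _ 0); last by rewrite mulr_ge0 ?exprn_ge0 ?subr_ge0.
  by rewrite -natr1; nra.
have : (1 - x) * (1 - n%:R * x) <= (1 - x) * (1 - x) ^+ n.
  by rewrite ler_wpM2l// subr_ge0.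
apply: le_trans; rewrite -natr1; have : 0 <= n%:R :> R by []. nra.
Qed.

Section volume.
Variable d : nat.
Implicit Types A B C : ('I_d -> R) -> bool.

Definition vol A : \bar R := rint (fun u => ((A u)%:R : R)%:E).

Definition bmeas A : Prop := rmeas (VP d) (fun u => (A u)%:R : R).

Lemma bmeas_le (f g : ('I_d -> R) -> R) :
  rmeas (VP d) f -> rmeas (VP d) g -> bmeas (fun u => f u <= g u).
Proof.
move=> mf mg; rewrite /bmeas.
have -> : (fun u => (f u <= g u)%R%:R) = (fun u => if f u <= g u then 1 else 0 : R).
  by apply/funext => u; case: ifP.
by apply: rmeas_if_le => //; exact: rmeas_cst.
Qed.

Lemma bmeas_lt (f g : ('I_d -> R) -> R) :
  rmeas (VP d) f -> rmeas (VP d) g -> bmeas (fun u => f u < g u).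
Proof.
move=> mf mg; rewrite /bmeas.
have -> : (fun u => (f u < g u)%R%:R) = (fun u => if g u <= f u then 0 else 1 : R).
  by apply/funext => u; rewrite ltNge; case: ifP.
by apply: rmeas_if_le => //; exact: rmeas_cst.
Qed.

Lemma bmeas_and A B : bmeas A -> bmeas B -> bmeas (fun u => A u && B u).
Proof.
move=> mA mB; rewrite /bmeas.
have -> : (fun u => (A u && B u)%:R) = (fun u => (A u)%:R * (B u)%:R : R).
  by apply/funext => u; case: (A u); case: (B u); rewrite ?mulr1 ?mulr0.
exact: rmeasM.
Qed.

Lemma vol_ge0 A : (0 <= vol A)%E.
Proof. by apply: (iop_ge0 (iop_rint R d)) => u; rewrite lee_fin. Qed.

Lemma le_vol A B : (forall u, A u -> B u) -> (vol A <= vol B)%E.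
Proof.
move=> AB; apply: (iop_le (iop_rint R d)) => u; first by rewrite lee_fin.
by rewrite lee_fin ler_nat; have := AB u; case: (A u) => //= ->.
Qed.

(** The inequality between Booleans read as numbers packs two facts into one: [A] and [B] are
    disjoint, and both lie in [C]. *)
Lemma vol_add_le A B C : bmeas A -> bmeas B ->
  (forall u, (A u + B u <= C u)%N) -> (vol A + vol B <= vol C)%E.
Proof.
move=> mA mB ABC; rewrite -(iopD (iop_rint R d)); try exact: rmeas_EFin.
- apply: (iop_le (iop_rint R d)) => u; rewrite -EFinD lee_fin ?addr_ge0//.
  by rewrite -natrD ler_nat ABC.
- by move=> u; rewrite lee_fin.
- by move=> u; rewrite lee_fin.
Qed.

Lemma vol_le_add A B C : bmeas A -> bmeas B ->
  (forall u, (C u <= A u + B u)%N) -> (vol C <= vol A + vol B)%E.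
Proof.
move=> mA mB ABC; rewrite -(iopD (iop_rint R d)); try exact: rmeas_EFin.
- apply: (iop_le (iop_rint R d)) => u; rewrite ?lee_fin//.
  by rewrite -natrD ler_nat ABC.
- by move=> u; rewrite lee_fin.
- by move=> u; rewrite lee_fin.
Qed.

Lemma vol_affine A (a : R) (b : 'I_d -> R) : a != 0 -> bmeas A ->
  vol (fun u => A (fun k => a * u k + b k)) = ((`|a| ^- d)%:E * vol A)%E.
Proof.
move=> a0 mA; apply: (rint_affine b (F := fun u => ((A u)%:R : R)%:E)) => //.
exact: rmeas_EFin.
Qed.

Lemma bmeas_comp A (phi : ('I_d -> R) -> 'I_d -> R) :
  (forall j, rmeas (VP d) (phi ^~ j)) -> bmeas A -> bmeas (fun u => A (phi u)).
Proof. by move=> mphi mA d' Z b pb; apply: (mA _ _ (phi \o b)) => j; exact: mphi. Qed.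

(** The reflection in the hyperplane through [y] is the linear one conjugated by a translation. *)
Lemma vol_reflect A (w y : 'I_d -> R) : dotp w w = 1 -> bmeas A ->
  vol (fun u => A (fun k => hreflect w (fun j => u j - y j) k + y k)) = vol A.
Proof.
move=> w1 mA.
have tr (b : 'I_d -> R) B : bmeas B -> vol (fun u => B (fun k => u k + b k)) = vol B.
  move=> mB; rewrite -[RHS]mul1e -[1%:E](_ : (`|1 : R| ^- d)%:E = _).
    rewrite -(vol_affine b)// ?oner_neq0//.
    by congr vol; apply/funext => u; congr B; apply/funext => k; rewrite mul1r.
  by rewrite normr1 expr1n invr1.
pose B u := A (fun k => u k + y k).
have mB : bmeas B.
  apply: (bmeas_comp (phi := fun u k => u k + y k)) mA => j.
  by apply: rmeasD; [exact: rmeas_coord|exact: rmeas_cst].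
pose C u := B (hreflect w u).
have mC : bmeas C.
  apply: (bmeas_comp (phi := hreflect w)) mB => j.
  apply: rmeasB; first exact: rmeas_coord.
  apply: rmeasM; [apply: rmeasM|]; try exact: rmeas_cst.
  by apply: rmeas_dotp => i; [exact: rmeas_cst|exact: rmeas_coord].
rewrite -[RHS](tr y)// -/(B _).
rewrite -[RHS](rint_reflect (w := w) (F := fun u => ((B u)%:R : R)%:E))//.
  exact: (tr (fun k => - y k) C).
exact: rmeas_EFin.
Qed.

End volume.
End geometry.

(** * The neighbourhood of a point of the ball and its two halves *)

Section cap.
Variables (R : realType) (d : nat) (y : 'I_d -> R) (r : R).
Notation RP := (@mplots _ (measurableTypeR R)).
Notation VP n := (@vplots n R RP).
Hypothesis y1 : dotp y y <= 1.
Hypothesis r0 : 0 < r.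

Definition sqdist (u v : 'I_d -> R) : R :=
  dotp (fun k => u k - v k) (fun k => u k - v k).

Definition unit_ball (u : 'I_d -> R) : bool := dotp u u <= 1.

Definition cap (u : 'I_d -> R) : bool := unit_ball u && (sqdist u y <= r ^+ 2).

Lemma rmeas_dotp_cst (w : 'I_d -> R) : rmeas (VP d) (fun u => dotp w u).
Proof. by apply: rmeas_dotp => j; [exact: rmeas_cst|exact: rmeas_coord]. Qed.

Lemma rmeas_sqnorm : rmeas (VP d) (fun u => dotp u u).
Proof. by apply: rmeas_dotp => j; exact: rmeas_coord. Qed.

Lemma rmeas_sqdist v : rmeas (VP d) (sqdist ^~ v).
Proof.
by apply: rmeas_dotp => j; apply: rmeasB; try exact: rmeas_coord; exact: rmeas_cst.
Qed.

Lemma bmeas_unit_ball : bmeas unit_ball.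
Proof. by apply: bmeas_le; [exact: rmeas_sqnorm|exact: rmeas_cst]. Qed.

Lemma bmeas_cap : bmeas cap.
Proof.
apply: bmeas_and; first exact: bmeas_unit_ball.
by apply: bmeas_le; [exact: rmeas_sqdist|exact: rmeas_cst].
Qed.

Lemma sqdist_homothety (t : R) (u : 'I_d -> R) :
  sqdist (fun k => t * u k + (1 - t) * y k) y = t ^+ 2 * sqdist u y.
Proof. by rewrite /sqdist /dotp mulr_sumr; apply: eq_bigr => k _; ring. Qed.

(** The homothety of centre [y] and ratio r/2 maps the unit ball into the cap: the ball is convex
    and its points are at distance at most 2 from [y]. *)
Lemma vol_cap_ge : r <= 1 -> (((r / 2) ^+ d)%:E * vol unit_ball <= vol cap)%E.
Proof.
move=> r1; have r20 : 0 < r / 2 by rewrite divr_gt0.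
rewrite -lee_pdivlMl ?exprn_gt0//.
rewrite -[X in (X ^+ d)^-1](gtr0_norm r20).
rewrite -(vol_affine (fun k => (1 - r / 2) * y k) (lt0r_neq0 r20))//; last first.
  exact: bmeas_cap.
apply: le_vol => u u1; apply/andP; split.
  by apply: dotp_convex => //; apply/andP; split; lra.
rewrite sqdist_homothety.
have : sqdist u y <= 4.
  have := dotp_ge0 (fun k => u k + y k); rewrite /sqdist !dotpE (dotpC y u).
  move: (dotp u y) u1 y1; rewrite /unit_ball => z; lra.
move=> h; have : (r / 2) ^+ 2 * sqdist u y <= (r / 2) ^+ 2 * 4.
  by rewrite ler_wpM2l ?sqr_ge0.
by move/le_trans; apply; rewrite expr_div_n; lra.
Qed.

(** The outer radius is chosen so that its square is at least 1 + 8 r^2, the bound met in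
    [vol_bad_le] for reflected points. *)
Definition shell (u : 'I_d -> R) : bool :=
  (1 < dotp u u) && (dotp u u <= (1 + 4 * r ^+ 2) ^+ 2) && (sqdist u y <= r ^+ 2).

Lemma bmeas_shell : bmeas shell.
Proof.
apply: bmeas_and; last by apply: bmeas_le; [exact: rmeas_sqdist|exact: rmeas_cst].
by apply: bmeas_and; [apply: bmeas_lt|apply: bmeas_le];
  try exact: rmeas_sqnorm; exact: rmeas_cst.
Qed.

Lemma vol_sum_le n (A : nat -> ('I_d -> R) -> bool) (C : ('I_d -> R) -> bool) :
  (forall m, bmeas (A m)) -> (forall u, (\sum_(m < n) A m u <= C u)%N) ->
  (\sum_(m < n) vol (A m) <= vol C)%E.
Proof.
move=> mA AC.
rewrite /vol -(iop_sum _ (f := fun (m : 'I_n) u => (A m u)%:R) (iop_rint R d))//.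
  apply: (iop_le (iop_rint R d)) => u; first by rewrite lee_fin sumr_ge0.
  by rewrite lee_fin -natr_sum ler_nat.
by move=> m; apply: (@rmeas_EFin R _ (VP d) (fun u => (A m u)%:R)); exact: mA.
Qed.

Let s := Num.sqrt d%:R : R.
Hypothesis d0 : (0 < d)%N.
Hypothesis rs : r * s <= 1 / 32.

(* Scaling the shell by the powers of 1 / (1 + 4 r^2) gives about 1 / (r sqrt d)
   disjoint copies of comparable volume, all inside a set that shrinks into the
   cap by a homothety of ratio 1 - 1 / (4 d). *)
Lemma vol_shell_le : (vol shell <= (86 * (r * s))%:E * vol cap)%E.
Proof.
have s1 : 1 <= s by rewrite /s -[leLHS]sqrtr1 ler_sqrt ?ler0n ?ler1n.
have ss : s ^+ 2 = d%:R by rewrite /s sqr_sqrtr.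
have s0 : 0 < s by lra.
have rs0 : 0 < r * s by rewrite mulr_gt0.
have r32 : r <= 1 / 32 by apply: le_trans rs; rewrite ler_peMr// ltW.
pose c := 1 + 4 * r ^+ 2.
have rr0 : 0 < r ^+ 2 by rewrite exprn_gt0.
have c1 : 1 < c by rewrite /c; lra.
have c2 : c ^+ 2 <= 4 by have : r ^+ 2 <= 1 / 32 by [nra]; rewrite /c; nra.
have c0 : 0 < c by lra.
(* The number of copies: small enough that the scaling factors c^-m, m <= M, stay within r / (4 s)
   of 1, yet at least 1 / (32 r s). *)
pose M := Num.truncn (1 / (16 * (r * s))).
have /andP[M1 M2] : M%:R <= 1 / (16 * (r * s)) < M.+1%:R.
  by apply: truncn_itv; rewrite divr_ge0// mulr_ge0// ltW.
have {}M1 : M%:R * (16 * (r * s)) <= 1 by rewrite -ler_pdivlMr// mulr_gt0.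
have {}M2 : 1 <= 32 * (r * s) * M%:R.
  move: M2; rewrite ltr_pdivrMr ?mulr_gt0// -natr1.
  by have := rs; move: (r * s) (M%:R : R) => x m; lra.
have M0 : 0 < M%:R :> R.
  by rewrite ltr0n lt0n; apply: contraTneq M2 => ->; rewrite mulr0 -ltNge.
have cV : 1 - c^-1 <= 4 * r ^+ 2.
  by rewrite -(ler_pM2r c0) mulrBl mulVf ?gt_eqF// /c; nra.
have cV01 : 0 <= 1 - c^-1 <= 1.
  by rewrite subr_ge0 invf_le1// ltW//= gerBl invr_ge0 ltW.
have pow_ge n : 1 - n%:R * (4 * r ^+ 2) <= (c ^+ n)^-1.
  apply: le_trans (_ : 1 - n%:R * (1 - c^-1) <= _).
    by rewrite lerB// ler_wpM2l.
  rewrite -exprVn; apply: le_trans (bernoulli_inequality n cV01) _.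
  by rewrite opprB addrC subrK.
(* The excess r^2 / (4 d) = 4 (r / (4 s))^2 absorbs the second-order effect of the scaling on the
   distance to [y]. *)
pose E (v : 'I_d -> R) := unit_ball v && (sqdist v y <= r ^+ 2 * (1 + (4 * d%:R)^-1)).
(* The exponent starts at 1, so that even the first copy lies in the unit ball. *)
pose S m (v : 'I_d -> R) := shell (fun k => c ^+ m.+1 * v k + 0).
have mS m : bmeas (S m).
  apply: (bmeas_comp (phi := fun v k => c ^+ m.+1 * v k + 0)) bmeas_shell => j.
  apply: rmeasD; last exact: rmeas_cst.
  by apply: rmeasM; [exact: rmeas_cst|exact: rmeas_coord].
have SQ m v : S m v -> 1 < c ^+ m.+1 ^+ 2 * dotp v v <= c ^+ 2.
  rewrite /S /shell -/c; under [fun k => _ + 0]eq_fun do rewrite addr0.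
  by rewrite !dotpE mulrA -expr2 => /andP[].
have step m : (m < M)%N -> m.+1%:R * (16 * (r * s)) <= 1.
  move=> mM; apply: le_trans M1; rewrite ler_wpM2r ?ler_nat//.
  by rewrite mulr_ge0// ltW.
have SE m v : (m < M)%N -> S m v -> E v.
  move=> mM Smv; have /andP[h1 h2] := SQ m v Smv.
  have := Smv; rewrite /S /shell => /andP[_].
  under [fun k => _ + 0]eq_fun do rewrite addr0.
  set L := c ^+ m.+1 in h1 h2 *.
  have L0 : 0 < L by rewrite exprn_gt0.
  have Lc : c <= L by rewrite /L -[leLHS]expr1 ler_weXn2l// ltW.
  rewrite /sqdist !dotpE (dotpC y v) => h3.
  apply/andP; split.
    rewrite /unit_ball -(ler_pM2l (_ : 0 < L ^+ 2)) ?exprn_gt0// mulr1.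
    by apply: le_trans h2 _; rewrite ler_pXn2r// nnegrE ltW.
  rewrite /sqdist !dotpE (dotpC y v).
  have := dotp_ge0 (fun k => L * v k - y k); rewrite !dotpE (dotpC y v).
  set vv := dotp v v in h1 h2 h3 *; set vy := dotp v y in h3 *.
  have := y1; set yy := dotp y y in h3 * => yy1.
  move=> h4.
  pose X := L ^+ 2 * vv; pose Y := L * vy; pose l := L^-1.
  have lL : l * L = 1 by rewrite /l mulVf// gt_eqF.
  (* Expansion of |v - y|^2 around the shell point L v. The linear term does not increase the
     distance: X >= Y because |L v| > 1 >= |y|. *)
  have -> : vv - vy - (vy - yy) =
      X - 2 * Y + yy - 2 * (1 - l) * (X - Y) + (1 - l) ^+ 2 * X.
    have -> : vv = l * L * (l * L) * vv by rewrite lL !mul1r.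
    have -> : vy = l * L * vy by rewrite lL !mul1r.
    by rewrite /X /Y; ring.
  have XY : X - 2 * Y + yy <= r ^+ 2 by move: h3; rewrite /X /Y; lra.
  have XY0 : 0 <= X - 2 * Y + yy by move: h4; rewrite /X /Y; lra.
  have l1 : 0 <= 1 - l.
    by rewrite subr_ge0 /l invf_le1// (le_trans _ Lc)// ltW.
  have ld : 1 - l <= r / (4 * s).
    have := pow_ge m.+1; rewrite -/L -/l => pl.
    apply: (@le_trans _ _ (m.+1%:R * (4 * r ^+ 2))); first by lra.
    have -> : m.+1%:R * (4 * r ^+ 2) = m.+1%:R * (16 * (r * s)) * (r / (4 * s)).
      by field; rewrite gt_eqF.
    by rewrite ler_piMl ?step// divr_ge0// ?mulr_ge0// ltW.
  have X4 : (1 - l) ^+ 2 * X <= (r / (4 * s)) ^+ 2 * 4.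
    apply: ler_pM; rewrite ?sqr_ge0//; first by rewrite /X; lra.
    - by rewrite ler_pXn2r// nnegrE// (le_trans l1).
    - by apply: le_trans c2.
  have -> : r ^+ 2 * (1 + (4 * d%:R)^-1) = r ^+ 2 + (r / (4 * s)) ^+ 2 * 4.
    by rewrite -ss; field; rewrite gt_eqF.
  have : 0 <= (1 - l) * (X - Y) by rewrite mulr_ge0//; rewrite /X in XY XY0 *; lra.
  lra.
(* Both c^(m+1) |v| and c^(m'+1) |v| would lie in (1, c], but their ratio is at least c. *)
have Suniq m m' v : (m < m')%N -> S m v -> S m' v -> False.
  move=> mm' /SQ /andP[h1 _] /SQ /andP[_ h2].
  have : c * c ^+ m.+1 <= c ^+ m'.+1 by rewrite -exprS ler_weXn2l// ltW.
  move=> cL; have cL2 : (c * c ^+ m.+1) ^+ 2 <= c ^+ m'.+1 ^+ 2.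
    have c0' := ltW c0.
    by rewrite ler_pXn2r// nnegrE ?mulr_ge0 ?exprn_ge0.
  have : c ^+ 2 * 1 < c ^+ 2 * (c ^+ m.+1 ^+ 2 * dotp v v).
    by rewrite ltr_pM2l// exprn_gt0.
  rewrite mulr1 mulrA -exprMn ltNge => /negP; apply.
  by apply: le_trans h2; rewrite ler_wpM2r// dotp_ge0.
have sumS : (\sum_(m < M) vol (S m) <= vol E)%E.
  apply: vol_sum_le => // u.
  have [[m Sm]|/forallNP noS] := pselect (exists m : 'I_M, S m u).
    rewrite (bigD1 m)//= big1 ?Sm ?addn0 ?(SE m)// => m' m'm.
    apply/eqP; rewrite eqb0; apply/negP => Sm'.
    have [h|h|h] := ltngtP m m'; [exact: (Suniq m m' u)|exact: (Suniq m' m u)|].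
    by move/eqP: m'm; apply; exact/esym/val_inj.
  by rewrite big1// => m _; apply/eqP; rewrite eqb0; apply/negP/noS.
(* This ratio satisfies t^2 (1 + 1/(4d)) <= 1, so the homothety sends [E] into the cap, and t^d >=
   3/4 by Bernoulli. *)
pose t : R := 1 - (4 * d%:R)^-1.
have d1 : 1 <= d%:R :> R by rewrite ler1n.
have d4 : 0 < (4 * d%:R : R)^-1 <= 1 / 4.
  have d0' : 0 < 4 * d%:R :> R by lra.
  have := mulVf (lt0r_neq0 d0'); have : 0 < (4 * d%:R)^-1 :> R by rewrite invr_gt0.
  set q := _^-1 => q0 qd; rewrite q0 /=; nra.
have t0 : 0 < t by rewrite /t; move/andP: d4; lra.
have volE : (vol E <= (4 / 3)%:E * vol cap)%E.
  apply: (@le_trans _ _ ((`|t| ^- d)%:E * vol cap)%E).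
    rewrite -(vol_affine (fun k => (1 - t) * y k) (lt0r_neq0 t0))//; last first.
      exact: bmeas_cap.
    apply: le_vol => v /andP[v1 vy]; apply/andP; split.
      by apply: dotp_convex => //; rewrite ltW//= /t; move/andP: d4; lra.
    rewrite sqdist_homothety.
    apply: (@le_trans _ _ (t ^+ 2 * (r ^+ 2 * (1 + (4 * d%:R)^-1)))).
      by rewrite ler_wpM2l// sqr_ge0.
    rewrite mulrCA ler_piMr ?sqr_ge0//.
    by move/andP: d4 => []; rewrite /t; set q := _^-1; nra.
  rewrite lee_wpmul2r ?vol_ge0// lee_fin gtr0_norm//.
  rewrite -[4 / 3]invf_div lef_pV2 ?posrE ?exprn_gt0// ?divr_gt0//.
  apply: le_trans (bernoulli_inequality d (_ : 0 <= (4 * d%:R)^-1 <= 1)).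
    rewrite le_eqVlt; apply/orP; left; apply/eqP; field.
    by rewrite gt_eqF// (lt_le_trans _ d1).
  by move/andP: d4 => [? ?]; apply/andP; split; lra.
(* By Bernoulli c^(-(m+1) d) >= 1 - 4 (m+1) d r^2 >= 1 - r s / 4. *)
have volS m : (m < M)%N -> ((1 / 2)%:E * vol shell <= vol (S m))%E.
  move=> mM; rewrite vol_affine ?expf_neq0 ?gt_eqF//; last exact: bmeas_shell.
  rewrite lee_wpmul2r ?vol_ge0// lee_fin gtr0_norm ?exprn_gt0// -exprM.
  apply: le_trans (pow_ge _).
  have -> : (m.+1 * d)%:R * (4 * r ^+ 2) = m.+1%:R * (16 * (r * s)) * (r * s / 4).
    by rewrite natrM -ss; field.
  have : m.+1%:R * (16 * (r * s)) * (r * s / 4) <= r * s / 4.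
    by rewrite ler_piMl ?step// divr_ge0// ltW.
  have := rs; lra.
have : ((M%:R / 2)%:E * vol shell <= (4 / 3)%:E * vol cap)%E.
  apply: le_trans (le_trans sumS volE).
  apply: (@le_trans _ _ (\sum_(m < M) (1 / 2)%:E * vol shell)%E).
    rewrite -ge0_sume_distrl//.
    rewrite sumEFin sumr_const card_ord lee_wpmul2r ?vol_ge0// lee_fin.
    by rewrite -[(1 / 2) *+ M]mulr_natl mul1r.
  by apply: lee_sum => m _; exact: volS.
(* The constant 86: (2 / M) (4 / 3) <= (8 / 3) 32 r s = (256 / 3) r s. *)
rewrite -lee_pdivlMl ?divr_gt0// muleA -EFinM => /le_trans; apply.
rewrite lee_wpmul2r ?vol_ge0// lee_fin invf_div.
rewrite mulrAC ler_pdivrMr//.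
lra.
Qed.

Section near.
Variable w : 'I_d -> R.
Hypothesis w1 : dotp w w = 1.

(** The set on the left lies in [near], the half of the cap below the hyperplane w.u = w.y. Since
    near <= far + shell by reflection and near + far <= cap, twice [near] is at most cap + shell. *)
Lemma vol_bad_le : r < dotp w y -> dotp w y <= 2 * r ->
  (2%:E * vol (fun u => cap u && (dotp w u <= r)%R) <=
   (1 + 86 * (r * s))%:E * vol cap)%E.
Proof.
move=> wy1 wy2.
pose near u := cap u && (dotp w u < dotp w y).
pose far u := cap u && (dotp w y < dotp w u).
have mnear : bmeas near.
  apply: bmeas_and; first exact: bmeas_cap.
  by apply: bmeas_lt; [exact: rmeas_dotp_cst|exact: rmeas_cst].
have mfar : bmeas far.
  apply: bmeas_and; first exact: bmeas_cap.
  by apply: bmeas_lt; [exact: rmeas_cst|exact: rmeas_dotp_cst].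
have near_far : (vol near <= vol far + vol shell)%E.
  rewrite -(vol_reflect y w1 mnear).
  apply: vol_le_add => //; first exact: bmeas_shell.
  move=> u; set p := fun k => _.
  have [/andP[/andP[p1 py] wp]|//] := boolP (near p).
  pose h := dotp w u - dotp w y.
  have wpE : dotp w p = dotp w y - h.
    by rewrite /p /hreflect !dotpE w1 /h; ring.
  have pyE : sqdist p y = sqdist u y.
    rewrite /sqdist /p /hreflect.
    under [fun k => _ + y k - y k]eq_fun do rewrite addrK.
    by rewrite !dotpE (dotpC y u) (dotpC u w) (dotpC y w) w1; ring.
  have ppE : dotp p p = dotp u u - 4 * h * dotp w y.
    by rewrite /p /hreflect !dotpE (dotpC y u) (dotpC u w) (dotpC y w) w1 /h; ring.
  have h0 : 0 < h by rewrite wpE in wp; lra.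
  have uy : sqdist u y <= r ^+ 2 by rewrite -pyE.
  have hr : h <= r.
    have : h ^+ 2 <= r ^+ 2.
      by apply: le_trans uy; rewrite /h -dotpBr; exact: dotp_unit_sqr.
    by rewrite ler_pXn2r// nnegrE ltW.
  have [u1|u1] := leP (dotp u u) 1.
    have -> : far u by rewrite /far /cap /unit_ball u1 uy /=; rewrite /h in h0; lra.
    by [].
  (* Since |p| <= 1, |u|^2 <= 1 + 4 h (w.y) <= 1 + 8 r^2 <= (1 + 4 r^2)^2. *)
  have -> : shell u.
    rewrite /shell u1 uy andbT /=; move: p1; rewrite /unit_ball ppE.
    have : h * dotp w y <= r * (2 * r) by rewrite ler_pM// ltW// (lt_trans r0).
    have : 0 <= r ^+ 2 ^+ 2 by rewrite sqr_ge0.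
    nra.
  by rewrite addn1.
apply: (@le_trans _ _ (vol cap + vol shell)%E); last first.
  have rs0 : 0 <= 86 * (r * s) by rewrite !mulr_ge0 ?sqrtr_ge0// ltW.
  by rewrite EFinD ge0_muleDl ?lee_fin// mul1e leeD2l// vol_shell_le.
apply: (@le_trans _ _ (vol near + vol near)%E).
  rewrite -[2]/(1 + 1) EFinD ge0_muleDl ?lee_fin// !mul1e.
  by apply: leeD; apply: le_vol => u /andP[cu h]; rewrite /near cu (le_lt_trans h).
apply: (@le_trans _ _ (vol near + (vol far + vol shell))%E); first by rewrite leeD2l.
rewrite addeA leeD2r//; apply: vol_add_le => // u.
rewrite /near /far; case: (cap u) => //=.
by case: ltgtP.
Qed.

End near.
End cap.

Section ball_volume.
Variables (R : realType) (d : nat).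
Notation leb := (fun F : R -> \bar R => (\int[@lebesgue_measure R]_t F t)%E).
Notation RP := (@mplots _ (measurableTypeR R)).
Notation VP n := (@vplots n R RP).

Lemma ball_indE (u : 'I_d -> R) : ball_ind u = (unit_ball u)%:R.
Proof. by rewrite /ball_ind /unit_ball norm2_le// expr1n; case: ifP. Qed.

Lemma ball_volE : ball_vol R d = vol (@unit_ball R d).
Proof. by congr rint; apply/funext => u; rewrite ball_indE. Qed.

Definition cube (a : R) (u : 'I_d -> R) : bool := [forall j, `|u j| <= a].

Lemma vol_cube (a : R) : 0 <= a -> vol (cube a) = ((2 * a) ^+ d)%:E.
Proof.
move=> a0; rewrite /vol rintE.
have -> : (fun u : 'I_d -> R => ((cube a u)%:R : R)%:E) =
    (fun u => (\prod_(j < d) (`|u j| <= a)%R%:R)%:E).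
  apply/funext => u; congr EFin; rewrite /cube.
  have [h|] := boolP [forall j, `|u j| <= a].
    by rewrite big1// => j _; move/forallP : h => ->.
  by rewrite negb_forall => /existsP[j /negPf hj]; rewrite (bigD1 j)//= hj mul0r.
rewrite (iter_prod 0 (integral_op_leb R) (f := fun=> fun t : R => (`|t| <= a)%R%:R)
  (C := fun=> 2 * a)) ?prodr_const ?card_ord//.
- move=> _; apply: (@rmeas_EFin R R RP (fun t => (`|t| <= a)%R%:R)).
  have -> : (fun t => (`|t| <= a)%R%:R) =
      (fun t => if `|t| <= a then 1 else 0) :> (R -> R).
    by apply/funext => t; case: ifP.
  apply: (@rmeas_if_le R R RP (fun t => `|t|) (fun=> a) (fun=> 1) (fun=> 0));
    try exact: rmeas_cst.
  by move=> e Z b mb; apply: measurableT_comp.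
- move=> _; transitivity (\int[@lebesgue_measure R]_t (\1_`[-a, a] t)%:E)%E.
    apply: eq_integral => t _; congr EFin.
    by rewrite indicE mem_setE in_itv /= ler_norml.
  rewrite integral_indic// setIT.
  apply: eq_trans (lebesgue_measure_itv `[- a, a]) _; rewrite /= lte_fin.
  have [h|h] := ltP (- a) a; first by rewrite -EFinB; congr EFin; ring.
  by have -> : a = 0 by [lra]; rewrite mulr0.
Qed.

(** The ball lies between the cubes of half-sides 1/d and 1. *)
Lemma ball_vol_fin : (0 < d)%N -> 0 < fine (ball_vol R d) /\
  ball_vol R d = (fine (ball_vol R d))%:E.
Proof.
move=> d0; have d0' : 0 < d%:R :> R by rewrite ltr0n.
have lo : (((2 * d%:R^-1) ^+ d)%:E <= ball_vol R d)%E.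
  rewrite -vol_cube ?invr_ge0// ball_volE; apply: le_vol => u /forallP h.
  apply: (@le_trans _ _ (\sum_(j < d) d%:R^-1)); last first.
    by rewrite sumr_const card_ord -[_ *+ d]mulr_natl divff// gt_eqF.
  apply: ler_sum => j _; rewrite -expr2 -real_normK ?num_real//.
  apply: (@le_trans _ _ (d%:R^-1 ^+ 2)).
    by rewrite ler_pXn2r// nnegrE ?invr_ge0.
  by rewrite expr2 ler_piMl ?invr_ge0// invf_le1// ler1n.
have hi : (ball_vol R d <= ((2 * 1) ^+ d)%:E)%E.
  rewrite -vol_cube// ball_volE; apply: le_vol => u hu; apply/forallP => j.
  have : u j ^+ 2 <= 1 ^+ 2.
    rewrite expr1n; apply: le_trans hu; rewrite /dotp (bigD1 j)//= -expr2 lerDl.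
    by apply: sumr_ge0 => k _; rewrite -expr2 sqr_ge0.
  by rewrite -real_normK ?num_real// ler_pXn2r// nnegrE.
have lo0 : 0 < (2 * d%:R^-1) ^+ d :> R by rewrite exprn_gt0// mulr_gt0// invr_gt0.
have fin : ball_vol R d \is a fin_num.
  rewrite ge0_fin_numE; first by apply: le_lt_trans hi _; rewrite ltry.
  by apply: le_trans lo; rewrite lee_fin ltW.
split; last by rewrite fineK.
by rewrite -lte_fin fineK//; apply: lt_le_trans lo.
Qed.

End ball_volume.

Section neighbourhood.
Variables (R : realType) (d : nat) (w : 'I_d -> R) (r : R).
Notation RP := (@mplots _ (measurableTypeR R)).
Notation VP n := (@vplots n R RP).
Hypothesis d0 : (0 < d)%N.
Hypothesis w1 : dotp w w = 1.
Hypothesis r0 : 0 < r.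
Hypothesis rs : r * Num.sqrt d%:R <= 1 / 32.

Let V := fine (ball_vol R d).

Lemma dist2_le (y u : 'I_d -> R) : (dist2 y u <= r) = (sqdist u y <= r ^+ 2).
Proof.
rewrite /dist2 (norm2_le _ (ltW r0)) (_ : dotp _ _ = sqdist u y)//.
by apply: eq_bigr => k _; ring.
Qed.

Lemma dotp_dist2 (y u : 'I_d -> R) : dist2 y u <= r -> `|dotp w u - dotp w y| <= r.
Proof.
rewrite dist2_le => uy; have : `|dotp w u - dotp w y| ^+ 2 <= r ^+ 2.
  rewrite real_normK ?num_real//; apply: le_trans uy.
  by rewrite -dotpBr; exact: dotp_unit_sqr.
by rewrite ler_pXn2r// nnegrE ltW.
Qed.

Definition bad (y u : 'I_d -> R) : bool := cap y r u && (`|dotp w u| <= r).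

Lemma bmeas_bad y : bmeas (bad y).
Proof.
apply: bmeas_and; first exact: bmeas_cap.
apply: bmeas_le; last exact: rmeas_cst.
move=> e Z b pb; apply: measurableT_comp => //.
exact: (rmeas_dotp_cst w pb).
Qed.

(** If |w.y| > 2r, no neighbour of [y] is in the slab and [bad y] is empty. Otherwise [vol_bad_le]
    applies to w or to -w, according to the sign of w.y. *)
Lemma vol_bad_abs (y : 'I_d -> R) : unit_ball y -> r < `|dotp w y| ->
  (2%:E * vol (bad y) <= (1 + 86 * (r * Num.sqrt d%:R))%:E * vol (cap y r))%E.
Proof.
move=> y1 ry.
have half w' : dotp w' w' = 1 -> r < dotp w' y <= 2 * r ->
    (forall u, `|dotp w u| <= r -> dotp w' u <= r) ->
    (2%:E * vol (bad y) <= (1 + 86 * (r * Num.sqrt d%:R))%:E * vol (cap y r))%E.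
  move=> w'1 /andP[h1 h2] ww'.
  apply: le_trans (vol_bad_le y1 r0 d0 rs w'1 h1 h2).
  by rewrite lee_wpmul2l// le_vol// => u /andP[-> /ww' ->].
have [ry2|ry2] := leP `|dotp w y| (2 * r); last first.
  apply: (@le_trans _ _ (1%:E * vol (cap y r))%E); last first.
    by rewrite lee_wpmul2r ?vol_ge0// lee_fin lerDl !mulr_ge0 ?sqrtr_ge0// ltW.
  rewrite mul1e -[2]/(1 + 1) EFinD ge0_muleDl// !mul1e.
  apply: vol_add_le; try exact: bmeas_bad.
  move=> u; have [|//] := boolP (bad y u) => /andP[/andP[_]].
  rewrite -dist2_le => /dotp_dist2; rewrite !ler_norml => /andP[h1 h2] /andP[h3 h4].
  by move: ry2; rewrite ltr_normr => /orP[]; lra.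
have [wy|wy] := leP 0 (dotp w y).
  apply: (half w) => //; first by move: ry ry2; rewrite ger0_norm// => -> ->.
  by move=> u; rewrite ler_norml => /andP[].
apply: (half (fun k => (-1) * w k)).
- by rewrite !dotpE w1; ring.
- by rewrite dotpZl mulN1r; move: ry ry2; rewrite ltr0_norm// => -> ->.
- by move=> u; rewrite dotpZl mulN1r ler_norml => /andP[]; lra.
Qed.

(* The factor of the exponential moment for a sensor at y contributed by another
   one at u: al in the slab, be outside it, 1 if u is not a neighbour of y. *)
Definition weight (al be : R) (y u : 'I_d -> R) : R :=
  if dist2 y u <= r then (if `|dotp w u| <= r then al else be) else 1.

Lemma weight_ge0 al be y u : 0 <= al -> 0 <= be -> 0 <= weight al be y u.
Proof. by move=> ? ?; rewrite /weight; do 2?case: ifP. Qed.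

Lemma rmeas_weight X (P : plots X) (f g : X -> 'I_d -> R) al be :
  (forall j, rmeas P (f ^~ j)) -> (forall j, rmeas P (g ^~ j)) ->
  rmeas P (fun x => weight al be (f x) (g x)).
Proof.
move=> mf mg; rewrite /weight.
have mgf j : rmeas P (fun x => g x j - f x j) by exact: rmeasB.
have -> : (fun x => if dist2 (f x) (g x) <= r then
      if `|dotp w (g x)| <= r then al else be else 1) =
    (fun x => if sqdist (g x) (f x) <= r ^+ 2 then
      if `|dotp w (g x)| <= r then al else be else 1).
  by apply/funext => x; rewrite dist2_le.
apply: rmeas_if_le; try exact: rmeas_cst; first exact: rmeas_dotp.
apply: rmeas_if_le; try exact: rmeas_cst.
move=> e Z b pb; apply: measurableT_comp => //.
by apply: (rmeas_dotp _ mg pb) => j; exact: rmeas_cst.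
Qed.

Lemma rmeas_ball X (P : plots X) (f : X -> 'I_d -> R) :
  (forall j, rmeas P (f ^~ j)) -> rmeas P (fun x => ball_ind (f x)).
Proof.
move=> mf.
have -> : (fun x => ball_ind (f x)) = (fun x => if dotp (f x) (f x) <= 1 then 1 else 0).
  by apply/funext => x; rewrite ball_indE /unit_ball; case: ifP.
by apply: rmeas_if_le; try exact: rmeas_cst; exact: rmeas_dotp.
Qed.

Lemma ball_ind_ge0 (u : 'I_d -> R) : 0 <= ball_ind u.
Proof. by rewrite ball_indE. Qed.

(** The probability that a uniform point of the ball is within [r] of [y]. *)
Definition capfrac (y : 'I_d -> R) : R := fine (vol (cap y r)) / V.

Lemma radius_le1 : r <= 1.
Proof.
have s1 : 1 <= Num.sqrt d%:R :> R by rewrite -[leLHS]sqrtr1 ler_sqrt ?ler0n ?ler1n.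
by have : r * 1 <= r * Num.sqrt d%:R; [rewrite ler_wpM2l// ltW|have := rs; lra].
Qed.

Lemma subball_vol_fin (A : ('I_d -> R) -> bool) :
  (forall u, A u -> unit_ball u) -> vol A = (fine (vol A))%:E.
Proof.
move=> AB; rewrite fineK// ge0_fin_numE ?vol_ge0//.
apply: (@le_lt_trans _ _ (ball_vol R d)); first by rewrite ball_volE le_vol.
by rewrite (ball_vol_fin R d0).2 ltry.
Qed.

Lemma capfrac_ge (y : 'I_d -> R) : unit_ball y -> (r / 2) ^+ d <= capfrac y.
Proof.
move=> y1; have [V0 VE] := ball_vol_fin R d0; rewrite -/V in V0 VE.
have := vol_cap_ge y1 r0 radius_le1.
rewrite (subball_vol_fin (A := cap y r)); last by move=> u /andP[].
by rewrite -ball_volE VE -EFinM lee_fin ler_pdivlMr.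
Qed.

(** Let A and B be the volumes of the cap and of its part in the slab. The integral is V + (be - 1)
    A + (al - be) B, where B <= (1/2 + 43 r sqrt d) A by [vol_bad_abs]; then 1 + x <= e^x. *)
Lemma rint_weight (al be e : R) (y : 'I_d -> R) :
  0 <= be -> be <= al ->
  (be - 1) + (al - be) * (1 / 2 + 43 * (r * Num.sqrt d%:R)) <= e ->
  unit_ball y -> r < `|dotp w y| ->
  exists2 C, rint (fun u => (ball_ind u * weight al be y u)%:E) = C%:E &
             0 <= C <= V * expR (capfrac y * e).
Proof.
move=> be0 beal he y1 ry.
have [V0 VE] := ball_vol_fin R d0; rewrite -/V in V0 VE.
have al0 : 0 <= al by exact: le_trans beal.
have fin := subball_vol_fin.
have capE := fin (cap y r) (fun u h => proj1 (andP h)).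
have badE := fin (bad y) (fun u h => proj1 (andP (proj1 (andP h)))).
pose good u := cap y r u && (r < `|dotp w u|).
have mgood : bmeas good.
  apply: bmeas_and; first exact: bmeas_cap.
  apply: bmeas_lt; first exact: rmeas_cst.
  move=> e' Z b pb; apply: measurableT_comp => //.
  exact: (rmeas_dotp_cst w pb).
have goodE := fin good (fun u h => proj1 (andP (proj1 (andP h)))).
have := vol_bad_abs y1 ry; rewrite badE capE -!EFinM lee_fin.
have mbad := bmeas_bad y.
have split_cap : (vol (bad y) + vol good = vol (cap y r))%E.
  apply/eqP; rewrite eq_le; apply/andP; split.
    apply: vol_add_le => // u; rewrite /bad /good; case: cap => //=.
    by case: leP.
  apply: vol_le_add => // u; rewrite /bad /good; case: cap => //=.
  by case: leP.
pose g u := ball_ind u * weight al be y u.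
have g0 u : 0 <= g u by rewrite mulr_ge0 ?ball_ind_ge0 ?weight_ge0.
have mg : meas_on (VP d) (fun u => (g u)%:E).
  apply: (@rmeas_EFin R _ (VP d) g); apply: rmeasM.
    by apply: rmeas_ball => j; exact: rmeas_coord.
  by apply: rmeas_weight => j; [exact: rmeas_cst|exact: rmeas_coord].
have mv (A : ('I_d -> R) -> bool) : bmeas A ->
    meas_on (VP d) (fun u => ((A u)%:R : R)%:E).
  by move=> mA; exact: rmeas_EFin.
have mvZ c (A : ('I_d -> R) -> bool) : bmeas A ->
    meas_on (VP d) (fun u => c%:E * ((A u)%:R : R)%:E)%E.
  move=> mA; apply: (@rmeas_EFin R _ (VP d) (fun u => c * (A u)%:R)).
  by apply: rmeasM; [exact: rmeas_cst|exact: mA].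
have volM c (A : ('I_d -> R) -> bool) : 0 <= c -> bmeas A ->
    (c%:E * vol A)%E = rint (fun u => c%:E * ((A u)%:R : R)%:E)%E.
  by move=> c0 mA; rewrite -(iopZ (iop_rint R d) c0)//; exact: mv.
have mD F G : meas_on (VP d) F -> meas_on (VP d) G ->
    meas_on (VP d) (fun u => F u + G u : \bar R)%E.
  by move=> mF mG e' Z b' pb; apply: emeasurable_funD; [exact: mF|exact: mG].
have mcap := bmeas_cap y r; have mball := @bmeas_unit_ball R d.
(* The cap is added on the left to avoid a subtraction, since [iopD] concerns nonnegative
   functions. *)
have key : (rint (fun u => (g u)%:E) + vol (cap y r) =
    vol (@unit_ball R d) + al%:E * vol (bad y) + be%:E * vol good)%E.
  rewrite !volM// -!(iopD (iop_rint R d))//.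
  all: try by [exact: mv|exact: mvZ|move=> u; rewrite ?adde_ge0 ?mule_ge0 ?lee_fin].
  - congr rint; apply/funext => u; rewrite -!EFinM -!EFinD; congr EFin.
    rewrite /g /weight dist2_le ball_indE /bad /good /cap.
    case: (unit_ball u); case: (_ <= r ^+ 2) => /=;
      rewrite ?(mul0r, mul1r, mulr0, add0r, addr0)//.
    by case: leP => _ /=; rewrite ?mulr0 ?mulr1 ?addr0 ?add0r addrC.
  - by apply: mD; [exact: mv|exact: mvZ].
have gge0 : (0 <= rint (fun u => (g u)%:E))%E.
  by apply: (iop_ge0 (iop_rint R d)) => u; rewrite lee_fin.
move: key gge0; rewrite capE badE goodE -ball_volE VE.
case E : (rint _) => [C| |] //=.
rewrite /capfrac; set A := fine (vol (cap y r)).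
set B := fine (vol (bad y)); set G := fine (vol good).
rewrite -!EFinM -!EFinD => -[key]; rewrite lee_fin => C0.
move: split_cap; rewrite capE badE goodE -/A -/B -/G -EFinD => -[BG] h2.
exists C => //; rewrite C0/=.
apply: (@le_trans _ _ (V * (1 + A / V * e))); last by rewrite ler_pM2l// expR_ge1Dx.
have -> : V * (1 + A / V * e) = V + A * e by field; rewrite gt_eqF.
have A0 : 0 <= A by rewrite -lee_fin -capE vol_ge0.
have : A * ((be - 1) + (al - be) * (1 / 2 + 43 * (r * Num.sqrt d%:R))) <= A * e.
  by rewrite ler_wpM2l.
have : (al - be) * (2 * B) <= (al - be) * ((1 + 86 * (r * Num.sqrt d%:R)) * A).
  by rewrite ler_wpM2l// subr_ge0.
move: (r * Num.sqrt d%:R) => x; nra.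
Qed.
End neighbourhood.

(** * Exponential moments *)

Section chernoff_integral.
Variables (R : realType) (d : nat).
Notation RP := (@mplots _ (measurableTypeR R)).
Notation VP n := (@vplots n R RP).
Notation PP n := (@vplots n ('I_d -> R) (VP d)).

Lemma pintE n : @pint R d n = @iter_op R ('I_d -> R) (@rint R d) (fun=> 0) n.
Proof. by elim: n => [|n IH] //; apply/funext => F /=; rewrite IH. Qed.

Lemma iop_pint n : integral_op (PP n) (@pint R d n).
Proof. by rewrite pintE; apply: integral_op_iter; exact: iop_rint. Qed.

Lemma pint_front n (i : 'I_n.+1) (F : ('I_n.+1 -> 'I_d -> R) -> \bar R) :
  (forall x, 0 <= F x)%E -> meas_on (PP _) F ->
  pint F = rint (fun y => pint (fun v => F (oinsert i y v))).
Proof.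
rewrite !pintE => F0 mF.
by rewrite [LHS](@iter_front _ _ _ _ (fun=> 0) (iop_rint R d)
  (@commute_rint R d d) _ i).
Qed.

Lemma pint_prod n (f : 'I_n -> ('I_d -> R) -> R) (C : 'I_n -> R) :
  (forall j x, 0 <= f j x) -> (forall j, rmeas (VP d) (f j)) ->
  (forall j, rint (fun x => (f j x)%:E) = (C j)%:E) ->
  pint (fun v => (\prod_j f j (v j))%:E) = (\prod_j C j)%:E.
Proof.
move=> f0 mf fC; rewrite pintE; apply: (iter_prod (fun=> 0) (iop_rint R d)) => // j.
exact: rmeas_EFin.
Qed.

Lemma rmeas_point n (k : 'I_n) j : rmeas (PP n) (fun x => x k j).
Proof. by move=> e Z b pb; exact: pb. Qed.

Variables (w : 'I_d -> R) (r : R).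
Hypothesis d0 : (0 < d)%N.
Hypothesis w1 : dotp w w = 1.
Hypothesis r0 : 0 < r.
Hypothesis rs : r * Num.sqrt d%:R <= 1 / 32.

Let V := fine (ball_vol R d).

Definition away (y : 'I_d -> R) : R := if `|dotp w y| <= r then 0 else 1.

(** The exponential moment for sensor [i] at given positions. The factor [away] keeps x_i out of the
    slab, as [rint_weight] requires. *)
Definition pair_weight n (i : 'I_n) (al be : 'I_n -> R) (x : 'I_n -> 'I_d -> R) : R :=
  away (x i) * \prod_(j < n | j != i) weight w r (al j) (be j) (x i) (x j).

Lemma pair_weight_ge0 n (i : 'I_n) (al be : 'I_n -> R) x :
  (forall j, 0 <= be j <= al j) -> 0 <= pair_weight i al be x.
Proof.
move=> h; apply: mulr_ge0; first by rewrite /away; case: ifP.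
apply: prodr_ge0 => j _; have /andP[b0 ba] := h j.
by apply: weight_ge0 => //; exact: le_trans ba.
Qed.

Lemma rmeas_pair_weight n (i : 'I_n) (al be : 'I_n -> R) :
  rmeas (PP n) (pair_weight i al be).
Proof.
apply: rmeasM.
  apply: rmeas_if_le; try exact: rmeas_cst.
  move=> e Z b pb; apply: measurableT_comp => //.
  apply: (rmeas_dotp _ (fun j => rmeas_point i j) pb) => j; exact: rmeas_cst.
have -> : (fun x : 'I_n -> 'I_d -> R =>
    \prod_(j < n | j != i) weight w r (al j) (be j) (x i) (x j)) =
    (fun x => \prod_(j < n) if j != i then weight w r (al j) (be j) (x i) (x j) else 1).
  by apply/funext => x; rewrite big_mkcond.
apply: (rmeas_prod (f := fun j x =>
  if j != i then weight w r (al j) (be j) (x i) (x j) else 1)) => j.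
case: (j != i) => /=; last exact: rmeas_cst.
by apply: rmeas_weight => // k; exact: rmeas_point.
Qed.

Lemma rmeas_prod_ball n :
  rmeas (PP n) (fun x : 'I_n -> 'I_d -> R => \prod_(k < n) ball_ind (x k)).
Proof. by apply: rmeas_prod => k; apply: rmeas_ball => j; exact: rmeas_point. Qed.

Lemma pint_ball n :
  pint (fun x : 'I_n -> 'I_d -> R => (\prod_(k < n) ball_ind (x k) : R)%:E) =
  (V ^+ n)%:E.
Proof.
have [_ VE] := ball_vol_fin R d0.
rewrite (pint_prod (f := fun=> @ball_ind R d) (C := fun=> V)) ?prodr_const ?card_ord//.
- by move=> _ x; exact: ball_ind_ge0.
- by move=> _; apply: rmeas_ball => j; exact: rmeas_coord.
Qed.

(** With x_i = y outermost, the integrals over the other positions factorize, each at most V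
    exp([capfrac r y] e_j). The exponents add up to at most -E [capfrac r y], and the fraction is at
    least (r/2)^d. *)
Lemma chernoff_integral n (i : 'I_n.+1) (al be e : 'I_n.+1 -> R) (E : R) :
  (forall j, 0 <= be j <= al j) ->
  (forall j, be j - 1 + (al j - be j) * (1 / 2 + 43 * (r * Num.sqrt d%:R)) <= e j) ->
  0 <= E -> \sum_(j < n.+1 | j != i) e j <= - E ->
  (pint (fun x => ((\prod_k ball_ind (x k)) * pair_weight i al be x)%:E) <=
   (V ^+ n.+1 * expR (- ((r / 2) ^+ d * E)))%:E)%E.
Proof.
move=> hal he E0 hE.
have [V0 VE] := ball_vol_fin R d0; rewrite -/V in V0 VE.
have prod0 x : 0 <= (\prod_(k < n.+1) ball_ind (x k)) * pair_weight i al be x :> R.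
  by rewrite mulr_ge0 ?pair_weight_ge0// prodr_ge0// => k _; exact: ball_ind_ge0.
rewrite (pint_front i)//; last first.
  apply: (@rmeas_EFin R _ (PP n.+1)
    (fun x => (\prod_k ball_ind (x k)) * pair_weight i al be x)).
  by apply: rmeasM; [exact: rmeas_prod_ball|exact: rmeas_pair_weight].
pose K := V ^+ n * expR (- ((r / 2) ^+ d * E)).
have K0 : 0 <= K by rewrite mulr_ge0 ?exprn_ge0 ?expR_ge0// ltW.
apply: (@le_trans _ _ (rint (fun y : 'I_d -> R => K%:E * (ball_ind y)%:E)%E)); last first.
  rewrite (iopZ (iop_rint R d))//.
  - by rewrite -/(ball_vol R d) VE -EFinM lee_fin /K mulrAC -exprSr.
  - by move=> u; rewrite lee_fin ball_ind_ge0.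
  - apply: (@rmeas_EFin R _ (VP d) (@ball_ind R d)).
    by apply: rmeas_ball => j; exact: rmeas_coord.
apply: (iop_le (iop_rint R d)) => y.
  by apply: (iop_ge0 (iop_pint n)) => v; rewrite lee_fin.
pose g j (u : 'I_d -> R) := ball_ind u * weight w r (al (lift i j)) (be (lift i j)) y u.
have -> : (fun v => ((\prod_k ball_ind (oinsert i y v k)) *
      pair_weight i al be (oinsert i y v))%:E) =
    (fun v => (ball_ind y * away y)%:E * (\prod_(j < n) g j (v j))%:E)%E.
  apply/funext => v; rewrite -EFinM; congr EFin.
  rewrite /pair_weight oinsert_at (bigD1_ord i)//= oinsert_at.
  rewrite [X in _ * (_ * X)](_ : _ =
      \prod_(j < n) weight w r (al (lift i j)) (be (lift i j)) y (v j)).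
    under eq_bigr do rewrite oinsert_lift.
    by rewrite big_split /=; ring.
  rewrite big_mkcond (bigD1_ord i)//= eqxx /= mul1r; apply: eq_bigr => j _.
  by rewrite oinsert_lift eq_sym neq_lift.
have g0 j u : 0 <= g j u.
  rewrite mulr_ge0 ?ball_ind_ge0// weight_ge0//;
    have /andP[h1 h2] := hal (lift i j) => //.
  exact: le_trans h2.
have mg j : rmeas (VP d) (g j).
  apply: rmeasM; first by apply: rmeas_ball => k; exact: rmeas_coord.
  by apply: rmeas_weight => // k; [exact: rmeas_cst|exact: rmeas_coord].
have mgp : meas_on (PP n) (fun v => (\prod_(j < n) g j (v j))%:E).
  apply: (@rmeas_EFin R _ (PP n) (fun v => \prod_(j < n) g j (v j))).
  apply: rmeas_prod => j e' Z b pb; exact: (mg j _ _ (fun z => b z j) (pb j)).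
have h0 : 0 <= ball_ind y * away y.
  by rewrite mulr_ge0 ?ball_ind_ge0// /away; case: ifP.
rewrite (iopZ (iop_pint n))//; last by move=> v; rewrite lee_fin prodr_ge0.
have [yb|yb] := boolP (unit_ball y); last first.
  by rewrite ball_indE (negPf yb) !mul0r !mul0e mule0.
have [yr|yr] := leP `|dotp w y| r.
  by rewrite /away yr mulr0 mul0e -EFinM lee_fin mulr_ge0 ?ball_ind_ge0.
have /choice[C hC] : forall j : 'I_n, exists C, rint (fun u => (g j u)%:E) = C%:E /\
    0 <= C <= V * expR (capfrac r y * e (lift i j)).
  move=> j; have /andP[b0 ba] := hal (lift i j).
  have [C h1 h2] := rint_weight d0 w1 r0 rs b0 ba (he (lift i j)) yb yr.
  by exists C.
rewrite (pint_prod g0 mg (fun j => (hC j).1)).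
have aw : away y = 1 by rewrite /away leNgt yr.
rewrite aw mulr1 muleC lee_wpmul2r ?lee_fin ?ball_ind_ge0//.
apply: (@le_trans _ _ (\prod_(j < n) (V * expR (capfrac r y * e (lift i j))))).
  by apply: ler_prod => j _; exact: (hC j).2.
rewrite big_split /= prodr_const card_ord /K ler_pM2l ?exprn_gt0//.
rewrite -expR_sum ler_expR -mulr_sumr.
have hE' : \sum_(j < n) e (lift i j) <= - E.
  apply: le_trans hE; rewrite [leRHS]big_mkcond [leRHS](bigD1_ord i)//= eqxx /= add0r.
  by under [leRHS]eq_bigr do rewrite eq_sym neq_lift.
have v0 := capfrac_ge d0 r0 rs yb.
have rho0 : 0 <= (r / 2) ^+ d by rewrite exprn_ge0// divr_ge0// ltW.
apply: (@le_trans _ _ (capfrac r y * - E)).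
  by rewrite ler_wpM2l// (le_trans rho0).
by rewrite mulrN lerN2 ler_wpM2r.
Qed.

End chernoff_integral.

(** * The dynamics for fixed positions and permutation *)

Section dynamics.
Variables (R : realType) (d N : nat) (w : 'I_d -> R) (r : R).
Hypothesis w1 : dotp w w = 1.
Hypothesis r0 : 0 < r.
Variables (x : 'I_N -> 'I_d -> R) (pi : {perm 'I_N}) (tb : tie_rule R d N).

(** The step at which sensor [j] updates. *)
Definition pos (j : 'I_N) : 'I_N := (pi^-1)%g j.

Lemma posK (k : 'I_N) : pos (pi k) = k.
Proof. by rewrite /pos permK. Qed.

Lemma pi_pos (j : 'I_N) : pi (pos j) = j.
Proof. by rewrite /pos permKV. Qed.

Section run.
Variable s0 : {ffun 'I_N -> bool}.
Notation run := (run r x s0 pi tb).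

Lemma run_update (k : 'I_N) :
  run k.+1 (pi k) = best_response r x (run k) (pi k) (tb x s0 pi k).
Proof. by rewrite /= valK eqxx. Qed.

Lemma run_other (k : nat) (j : 'I_N) : k != pos j :> nat -> run k.+1 j = run k j.
Proof.
move=> kj /=; case: insubP => [kk _ kkE|//]; case: eqP => // jE.
by move: kj; rewrite jE posK kkE eqxx.
Qed.

Lemma run_before (k : nat) (j : 'I_N) : (k <= pos j)%N -> run k j = s0 j.
Proof.
elim: k => [//|k IH] kj; rewrite run_other ?IH//; first exact: ltnW.
by rewrite neq_ltn kj.
Qed.

Lemma run_after (k : nat) (j : 'I_N) : (pos j < k)%N -> run k j = run (pos j).+1 j.
Proof.
elim: k => [//|k IH]; rewrite ltnS leq_eqVlt => /orP[/eqP <-//|jk].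
by rewrite run_other ?IH// neq_ltn jk orbT.
Qed.

(** [wr] may overcount the neighbours in the wrong state. A strict majority outside [wr] still
    decides the update, whatever [tie] is. *)
Lemma best_response_majority (s : 'I_N -> bool) (i : 'I_N) (t tie : bool)
    (wr : pred 'I_N) :
  (forall j, neighbor r x i j -> ~~ wr j -> s j = t) ->
  (#|[set j | neighbor r x i j & wr j]| < #|[set j | neighbor r x i j & ~~ wr j]|)%N ->
  best_response r x s i tie = t.
Proof.
move=> wrP maj; rewrite /best_response.
have le_t : (#|[set j | neighbor r x i j & s j != t]| <
    #|[set j | neighbor r x i j & s j == t]|)%N.
  apply: (@leq_ltn_trans #|[set j | neighbor r x i j & wr j]|).
    apply: subset_leq_card; apply/fintype.subsetP => j; rewrite !inE => /andP[nj sj].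
    by rewrite nj /=; apply: contraR sj => /(wrP _ nj) ->.
  apply: (leq_trans maj); apply: subset_leq_card; apply/fintype.subsetP => j.
  by rewrite !inE => /andP[nj /(wrP _ nj) ->]; rewrite nj eqxx.
have E1 : [set j | neighbor r x i j & s j] = [set j | neighbor r x i j & s j == true].
  by apply/setP => j; rewrite !inE eqb_id.
have E2 : [set j | neighbor r x i j & ~~ s j] =
    [set j | neighbor r x i j & s j == false].
  by apply/setP => j; rewrite !inE eqbF_neg.
rewrite E1 E2; case: t {wrP} le_t => le_t.
  have -> : [set j | neighbor r x i j & s j == false] =
      [set j | neighbor r x i j & s j != true].
    by apply/setP => j; rewrite !inE; case: (s j).
  by rewrite le_t.
have -> : [set j | neighbor r x i j & s j == true] =
    [set j | neighbor r x i j & s j != false].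
  by apply/setP => j; rewrite !inE; case: (s j).
by rewrite le_t ltnNge ltnW.
Qed.

(** Between neighbours w.x changes by at most r, too little to cross the hyperplane. *)
Lemma target_neighbor (i j : 'I_N) : neighbor r x i j -> r < `|dotp w (x i)| ->
  target w (x j) = target w (x i).
Proof.
move=> /andP[_ /(dotp_dist2 w1 r0)]; rewrite /target ler_norml ltr_normr.
by move=> /andP[h1 h2] /orP[h|h]; apply/idP/idP; lra.
Qed.

Variable K : nat.

(* A pessimistic count for the update at step k: an early sensor distrusts the
   updated neighbours in the slab and the others that start wrong; a late sensor
   trusts exactly the neighbours updated in the first K steps. *)
Definition wrong (k : 'I_N) (s : 'I_N -> bool) (j : 'I_N) : bool :=
  if (k < K)%N then
    if (pos j < k)%N then `|dotp w (x j)| <= r else s j != target w (x j)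
  else (K <= pos j)%N.

(** It is applied to the initial states, not to the states of the run, so that independence remains
    available. *)
Definition bad_step (s : 'I_N -> bool) (k : 'I_N) : bool :=
  (r < `|dotp w (x (pi k))|) &&
  (#|[set j | neighbor r x (pi k) j & ~~ wrong k s j]| <=
   #|[set j | neighbor r x (pi k) j & wrong k s j]|)%N.

(** Strong induction on time: neighbours updated earlier outside the slab are correct, and those not
    yet updated still have their initial state. *)
Lemma run_early : (forall k, ~~ bad_step s0 k) -> forall k : 'I_N,
  (k < K)%N -> r < `|dotp w (x (pi k))| ->
  run k.+1 (pi k) = target w (x (pi k)).
Proof.
move=> nbad k; have [m] := ubnP (val k); elim: m k => // m IH k km kK rk.
rewrite run_update; apply: (@best_response_majority _ _ _ _ (wrong k s0)).
  move=> j nj; rewrite /wrong kK; have [jk|kj] := ltnP (pos j) k.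
    rewrite -ltNge => rj; rewrite run_after// -[in LHS](pi_pos j) posK.
    rewrite IH ?pi_pos//; first exact: target_neighbor.
    - exact: leq_trans jk _.
    - exact: ltn_trans kK.
  by rewrite negbK => /eqP s0j; rewrite run_before// s0j; exact: target_neighbor.
by have := nbad k; rewrite /bad_step rk /= -ltnNge.
Qed.

Lemma good_event_no_bad_step : (forall k, ~~ bad_step s0 k) ->
  good_event w r x s0 pi tb.
Proof.
move=> nbad; apply/forallP => k; apply/implyP => rk2; apply/eqP.
have rk : r < `|dotp w (x (pi k))|.
  by apply: le_lt_trans rk2; have := r0; lra.
have [kK|Kk] := ltnP k K; first exact: run_early.
rewrite run_update; apply: (@best_response_majority _ _ _ _ (wrong k s0)).
  move=> j nj; rewrite /wrong ltnNge Kk /= -ltnNge => jK.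
  have jk : (pos j < k)%N by exact: leq_trans Kk.
  rewrite run_after// -[in LHS](pi_pos j) posK run_early ?pi_pos//.
    exact: target_neighbor.
  (* The margin 2r leaves every neighbour outside the slab, so [run_early] covers it. *)
  have /andP[_ /(dotp_dist2 w1 r0)] := nj; move: rk2; rewrite ler_norml !ltr_normr.
  by move=> /orP[h|h] /andP[h1 h2]; apply/orP; [left|right]; lra.
by have := nbad k; rewrite /bad_step rk /= -ltnNge.
Qed.

End run.

Section expectation.
Variables (K : nat) (q : 'I_N -> R) (eta : R).
Hypothesis hq : forall i, 0 <= q i <= eta.
Hypothesis eta1 : eta <= 1.

Definition init_prob (s : {ffun 'I_N -> bool}) : R :=
  \prod_(i < N) (if s i == target w (x i) then 1 - q i else q i).

Lemma init_prob_ge0 s : 0 <= init_prob s.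
Proof.
apply: prodr_ge0 => i _; have /andP[q0 q1] := hq i.
by case: ifP => _ //; rewrite subr_ge0 (le_trans q1).
Qed.

(** Independence of the initial states: the expectation of a product is the product of the
    expectations. *)
Lemma sum_init_prob (phi : 'I_N -> bool -> R) :
  \sum_(s : {ffun 'I_N -> bool}) init_prob s * \prod_(i < N) phi i (s i) =
  \prod_(i < N) ((1 - q i) * phi i (target w (x i)) + q i * phi i (~~ target w (x i))).
Proof.
rewrite /init_prob; under eq_bigr do rewrite -big_split /=.
rewrite -(bigA_distr_bigA (fun i b =>
  (if b == target w (x i) then 1 - q i else q i) * phi i b)).
apply: eq_bigr => i _; rewrite big_bool /=.
by case: (target w (x i)) => //=; rewrite addrC.
Qed.

Lemma sum_init_prob1 : \sum_s init_prob s = 1.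
Proof.
have := sum_init_prob (fun _ _ => 1); rewrite [RHS]big1; last by move=> i _; ring.
by move=> <-; apply: eq_bigr => s _; rewrite big1// mulr1.
Qed.

Variable a : 'I_N -> R.
Hypothesis a1 : forall k, 1 <= a k.

(** The expected factor of a neighbour in the slab: a if it counts as wrong, 1/a if as right, and
    the mean at error rate [eta] if its initial state decides. [weight_good] is the analogue outside
    the slab; they differ only for neighbours already updated at an early step. *)
Definition weight_bad (k j : 'I_N) : R :=
  if (k < K)%N then
    if (pos j < k)%N then a k else eta * a k + (1 - eta) * (a k)^-1
  else if (K <= pos j)%N then a k else (a k)^-1.

Definition weight_good (k j : 'I_N) : R :=
  if (k < K)%N then
    if (pos j < k)%N then (a k)^-1 else eta * a k + (1 - eta) * (a k)^-1
  else if (K <= pos j)%N then a k else (a k)^-1.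

(* Markov's inequality for a ^ (#wrong - #right). *)
Lemma bad_step_le (s : 'I_N -> bool) (k : 'I_N) :
  (bad_step K s k)%:R <= away w r (x (pi k)) *
    \prod_(j < N | neighbor r x (pi k) j) (if wrong K k s j then a k else (a k)^-1).
Proof.
have ak : 0 < a k by apply: lt_le_trans (a1 k).
have p0 : 0 <= \prod_(j < N | neighbor r x (pi k) j)
    (if wrong K k s j then a k else (a k)^-1).
  by apply: prodr_ge0 => j _; case: ifP => _; rewrite ?invr_ge0 ltW.
have [/andP[rk le]|_] := boolP (bad_step K s k); last first.
  by rewrite mulr_ge0// /away; case: ifP.
have aw : away w r (x (pi k)) = 1 by rewrite /away leNgt rk.
rewrite aw mul1r (bigID (wrong K k s)) /=.
rewrite (eq_bigr (fun=> a k)); last by move=> j /andP[_ ->].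
rewrite [X in _ * X](eq_bigr (fun=> (a k)^-1)); last by move=> j /andP[_ /negPf ->].
rewrite !prodr_const exprVn.
rewrite -[X in _ <= _ ^+ X / _](cardsE (fun j => _ && _)).
rewrite -[X in _ <= _ / _ ^+ X](cardsE (fun j => _ && _)).
by rewrite ler_pdivlMr ?exprn_gt0// mul1r ler_weXn2l.
Qed.

Lemma expect_bad_step_le (k : 'I_N) :
  \sum_s init_prob s * (bad_step K s k)%:R <=
  pair_weight w r (pi k) (weight_bad k) (weight_good k) x.
Proof.
have ak : 0 < a k by apply: lt_le_trans (a1 k).
have ai1 : (a k)^-1 <= 1 by rewrite invf_le1.
have ai0 : 0 <= (a k)^-1 by rewrite invr_ge0 ltW.
(* The factor of [j] depends on the initial states only through that of [j], as [sum_init_prob]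
   requires. *)
pose phi j b := if neighbor r x (pi k) j then
  (if (if (k < K)%N then
      if (pos j < k)%N then `|dotp w (x j)| <= r else b != target w (x j)
    else (K <= pos j)%N) then a k else (a k)^-1) else 1.
have aw0 : 0 <= away w r (x (pi k)) by rewrite /away; case: ifP.
apply: (@le_trans _ _ (\sum_s away w r (x (pi k)) *
    (init_prob s * \prod_(j < N) phi j (s j)))).
  apply: ler_sum => s _; rewrite mulrCA ler_wpM2l ?init_prob_ge0//.
  by apply: le_trans (bad_step_le s k) _; rewrite /phi -big_mkcond.
rewrite -mulr_sumr sum_init_prob /pair_weight ler_wpM2l//.
rewrite [leRHS]big_mkcond; apply: ler_prod => j _.
have /andP[q0 q1] := hq j.
have q11 : 0 <= 1 - q j by rewrite subr_ge0 (le_trans q1).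
have phi0 b : 0 <= phi j b.
  rewrite /phi; case: ifP => // _; set c := (X in if X then _ else _).
  by case: c => //; exact: ltW.
rewrite addr_ge0 ?mulr_ge0//=.
have [->|ji] := eqVneq j (pi k); first by rewrite /phi /neighbor eqxx /=; lra.
rewrite /phi /weight /neighbor eq_sym ji /=; case: ifP => _; last by lra.
rewrite /weight_bad /weight_good; case: (k < K)%N => /=; last first.
  by case: (K <= pos j)%N => /=; case: (_ <= r) => /=; lra.
case: (pos j < k)%N => /=; first by case: (_ <= r) => /=; lra.
rewrite eqxx /= (_ : (~~ target w (x j)) != target w (x j)); last by case: target.
(* The error rate q_j may be raised to [eta] because a >= 1/a. *)
rewrite if_same; have : 0 <= (eta - q j) * (a k - (a k)^-1); last by lra.
by rewrite mulr_ge0 ?subr_ge0// (le_trans ai1).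
Qed.

End expectation.
End dynamics.

(** * The union bound *)

Section arithmetic.
Variable R : realType.

Lemma sum_step (k N : nat) (A B : R) : (k <= N)%N ->
  \sum_(m < N) (if (m < k)%N then A else B) = k%:R * A + (N - k)%:R * B.
Proof.
move=> kN; rewrite -(big_mkord xpredT (fun m => if (m < k)%N then A else B)).
rewrite (big_cat_nat (leq0n k) kN) /=; congr (_ + _).
  rewrite (eq_big_nat _ _ (F2 := fun=> A)); last by move=> m /andP[_ ->].
  by rewrite sumr_const_nat subn0 mulr_natl.
rewrite (eq_big_nat _ _ (F2 := fun=> B)); last first.
  by move=> m /andP[km _]; rewrite ltnNge km.
by rewrite sumr_const_nat mulr_natl.
Qed.

(* With X = (r/2)^d g^2 N / 64, one has X e^(-X/2) <= 2 and, with
   u = r^d g delta, e^(-X/2) <= u^3. *)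
Lemma union_bound_small (d N : nat) (r g delta : R) : (0 < d)%N ->
  0 < r -> r <= 1 / 16 -> 0 < g -> g <= 1 / 2 -> 0 < delta -> delta < 1 ->
  6 * 64 / ((r / 2) ^+ d * g ^+ 2) * ln (1 / (r ^+ d * g * delta)) <= N%:R ->
  (8 <= N)%N /\
  N%:R * expR (- ((r / 2) ^+ d * (g ^+ 2 * N%:R / 64))) <= delta.
Proof.
move=> d0 r0 r1 g0 g1 de0 de1.
set rho := (r / 2) ^+ d; set u := r ^+ d * g * delta.
have pow_le1 (z : R) : 0 <= z -> z <= 1 -> z ^+ d <= z.
  by move=> z0 z1; case: d d0 {rho u} => // n _; rewrite exprS ler_piMr// exprn_ile1.
have rd0 : 0 < r ^+ d by rewrite exprn_gt0.
have rd1 : r ^+ d <= 1 / 16 by apply: (le_trans _ r1); apply: pow_le1; lra.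
have rho0 : 0 < rho by rewrite exprn_gt0// divr_gt0.
have rho1 : rho <= 1 by have : rho <= r / 2 by [apply: pow_le1; lra]; lra.
have gg0 : 0 < g ^+ 2 by rewrite exprn_gt0.
have gg1 : g ^+ 2 <= 1 by rewrite exprn_ile1//; lra.
have u0 : 0 < u by rewrite !mulr_gt0.
have u1 : u <= 1 / 2.
  have : r ^+ d * g <= 1 / 2 * 1 by apply: ler_pM; lra.
  have : r ^+ d * g * delta <= r ^+ d * g * 1 by rewrite ler_pM2l ?mulr_gt0// ltW.
  by rewrite -/u; lra.
pose L := ln (1 / u); rewrite -/L.
have lnu : L = - ln u by rewrite /L div1r lnV ?posrE.
have L1 : 1 / 2 <= L.
  have := le_ln1Dx (_ : -1 < u - 1); rewrite (_ : 1 + (u - 1) = u); last by ring.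
  by rewrite lnu => /(_ _); have := u0; have := u1; lra.
have rg0 : 0 < rho * g ^+ 2 by rewrite mulr_gt0.
have rg1 : rho * g ^+ 2 <= 1 by rewrite mulr_ile1// ltW.
rewrite mulrAC ler_pdivrMr// => hN; split.
  rewrite -(ler_nat R); apply: le_trans (_ : N%:R * (rho * g ^+ 2) <= _); first by lra.
  by rewrite ler_piMr.
pose X := rho * (g ^+ 2 * N%:R / 64); rewrite -/X.
(* The factor 6 * 64 in the hypothesis serves this bound: half of X then yields the cube of u. *)
have X6 : 6 * L <= X by rewrite /X; lra.
have XE : X = X / 2 + X / 2 by lra.
have e0 : 0 < expR (- (X / 2)) by exact: expR_gt0.
have Xe : X * expR (- (X / 2)) <= 2.
  have h : X <= 2 * expR (X / 2) by have := expR_ge1Dx (X / 2); lra.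
  have : X * expR (- (X / 2)) <= 2 * expR (X / 2) * expR (- (X / 2)).
    by rewrite ler_pM2r.
  by rewrite -mulrA -expRD subrr expR0 mulr1.
have eu : expR (- (X / 2)) <= u ^+ 3.
  have -> : u ^+ 3 = expR (3 * ln u) by rewrite expRM_natl lnK ?posrE//.
  by rewrite ler_expR; lra.
have NX : N%:R = 64 / (rho * g ^+ 2) * X by rewrite /X; field; rewrite !gt_eqF.
have X0 : 0 <= X by lra.
clearbody X; rewrite {1}NX {2}XE opprD expRD.
apply: (@le_trans _ _ (64 / (rho * g ^+ 2) * (2 * u ^+ 3))).
  rewrite -[leLHS]mulrA ler_pM2l ?divr_gt0// mulrA.
  by apply: ler_pM; rewrite ?mulr_ge0 ?expR_ge0.
(* The cube of u outweighs the denominator (r/2)^d g^2; what is left is small because (2 r^2)^d <= 2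
   r^2 <= 1/128. *)
have -> : 64 / (rho * g ^+ 2) * (2 * u ^+ 3) = 128 * (2 * r ^+ 2) ^+ d * g * delta ^+ 3.
  have -> : (2 * r ^+ 2) ^+ d = 2 ^+ d * (r ^+ d) ^+ 2.
    by rewrite exprMn -!exprM mulnC.
  have t0 : 2 ^+ d != 0 :> R by rewrite expf_neq0.
  rewrite /rho /u expr_div_n; move: (2 ^+ d) t0 (r ^+ d) (lt0r_neq0 rd0) => t t0 s s0.
  by field; rewrite s0 t0 lt0r_neq0.
have r2 : (2 * r ^+ 2) ^+ d <= 1 / 128.
  have h : r ^+ 2 <= 1 / 16 * (1 / 16) by rewrite expr2 ler_pM// ltW.
  apply: le_trans (pow_le1 _ _ _) _; rewrite ?mulr_ge0 ?sqr_ge0//; lra.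
have r2' : 0 <= (2 * r ^+ 2) ^+ d by rewrite exprn_ge0// mulr_ge0// sqr_ge0.
have d3 : delta ^+ 3 <= delta by rewrite exprSr ler_piMl ?exprn_ile1// ltW.
have : (2 * r ^+ 2) ^+ d * g <= 1 / 128 * 1 by apply: ler_pM; lra.
move=> h; apply: (le_trans _ d3); rewrite ler_piMl//; last by lra.
by rewrite exprn_ge0// ltW.
Qed.

End arithmetic.

Section union_bound.
Variables (R : realType) (d N : nat) (w : 'I_d -> R) (r : R).
Notation RP := (@mplots _ (measurableTypeR R)).
Notation VP n := (@vplots n R RP).
Notation PP n := (@vplots n ('I_d -> R) (VP d)).

(** Union bound over the steps, averaged over permutations. The lower bound involves neither [q] nor
    [tb] and is measurable in the positions. *)
Lemma cond_prob_good_ge (q : ('I_N -> 'I_d -> R) -> 'I_N -> R) (tb : tie_rule R d N)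
    (eta : R) (K : nat) (a : 'I_N -> R) (x : 'I_N -> 'I_d -> R) :
  dotp w w = 1 -> 0 < r -> (forall x i, 0 <= q x i <= eta) -> eta <= 1 ->
  (forall k, 1 <= a k) ->
  1 - \sum_(p : {perm 'I_N} * 'I_N) (N`!%:R^-1 *
    pair_weight w r (p.1 p.2) (weight_bad p.1 K eta a p.2) (weight_good p.1 K eta a p.2) x)
  <= cond_prob_good w r q tb x.
Proof.
move=> w1 r0 hq eta1 a1; rewrite /cond_prob_good.
have F0 : 0 < N`!%:R :> R by rewrite ltr0n fact_gt0.
apply: (@le_trans _ _ (\sum_s init_prob w x (q x) s *
    (1 - \sum_(p : {perm 'I_N} * 'I_N) N`!%:R^-1 * (bad_step w r x p.1 K s p.2)%:R))).
  under [leRHS]eq_bigr do rewrite mulrBr mulr1 mulr_sumr.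
  rewrite sumrB sum_init_prob1 lerB// exchange_big /=; apply: ler_sum => p _.
  under eq_bigr do rewrite mulrCA.
  rewrite -mulr_sumr ler_wpM2l ?invr_ge0 ?ler0n//.
  exact: expect_bad_step_le.
apply: ler_sum => s _; rewrite ler_wpM2l//; first exact: (init_prob_ge0 w x (hq x) eta1).
rewrite ler_pdivlMr// mulrBl mul1r -mulr_sumr mulrAC mulVf ?gt_eqF// mul1r.
rewrite -(pair_big xpredT xpredT (fun p k => (bad_step w r x p K s k)%:R)) /=.
rewrite -card_Sn -sum1_card natr_sum -sumrB; apply: ler_sum => p _.
have [good|] := boolP (good_event w r x s p tb).
  by rewrite lerBlDr lerDl sumr_ge0.
move=> ngood; have [k bk] : exists k, bad_step w r x p K s k.
  apply/existsP; apply: contraR ngood; rewrite negb_exists => /forallP nb.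
  exact: (good_event_no_bad_step w1 r0 tb nb).
by rewrite (bigD1 k)//= bk subr_le0 lerDl sumr_ge0.
Qed.

End union_bound.

(** * Choice of the tilts and the resulting exponents *)

Section exponents.
Variables (R : realType) (N : nat) (pi : {perm 'I_N}) (g : R).
Hypothesis g0 : 0 < g.
Hypothesis g1 : g <= 1 / 2.
Let K := (N - N %/ 4)%N.

(** The base a of the exponential moment. The mean advantage is of order g at an early step, so a -
    1 must be of order g; at a late step it is of order 1. *)
Definition tilt (k : 'I_N) : R := if (k < K)%N then 1 + g / 8 else 2.

(** The exponents e_j for [chernoff_integral]. In units of g^2/64, three quarters of the sensors at
    1 and one quarter at -15 average to -3; at a late step three quarters at -1/2 and one quarter at
    1 average to -1/8. *)
Definition log_weight (k j : 'I_N) : R :=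
  if (k < K)%N then
    if (pos pi j < k)%N then g ^+ 2 / 64 else - (15 * (g ^+ 2 / 64))
  else if (pos pi j < K)%N then - (1 / 2) else 1.

Lemma tilt_ge1 k : 1 <= tilt k.
Proof. by have := g0; rewrite /tilt; case: ifP => _; lra. Qed.

(** At an early step put h = g/8, so 1/a <= 1 - h + h^2. An updated neighbour gives at most h^2/2 +
    2ht <= g^2/64, another one at most -2gh + (1/2 + g) h^2 <= -15 g^2/64. *)
Lemma weight_log_weight (k j : 'I_N) (t : R) : 0 <= t -> t <= g / 32 ->
  let al := weight_bad pi K (1 / 2 - g) tilt k j in
  let be := weight_good pi K (1 / 2 - g) tilt k j in
  0 <= be <= al /\ be - 1 + (al - be) * (1 / 2 + t) <= log_weight k j.
Proof.
move=> t0 t1; have gp := g0; have gh := g1; rewrite /weight_bad /weight_good /log_weight /tilt.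
case: (k < K)%N => /=; last first.
  by rewrite leqNgt; case: (pos pi j < K)%N => /=; split; lra.
pose b := (1 + g / 8)^-1.
have b0 : 0 <= b by rewrite invr_ge0; lra.
have bE : b * (1 + g / 8) = 1 by rewrite mulVf// gt_eqF//; lra.
have b1 : b <= 1 by rewrite invf_le1; lra.
have b2 : b <= 1 - g / 8 + (g / 8) ^+ 2.
  have : 0 <= b * (g / 8) ^+ 3 by rewrite mulr_ge0// exprn_ge0//; lra.
  have -> : b * (g / 8) ^+ 3 = 1 - g / 8 + (g / 8) ^+ 2 - b +
      (b * (1 + g / 8) - 1) * ((g / 8) ^+ 2 - g / 8 + 1) by ring.
  by rewrite bE subrr mul0r addr0; lra.
rewrite -/b; case: (pos pi j < k)%N => /=; split.
- by rewrite b0; lra.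
- have : (b - 1) * (1 / 2 - t) <= (- (g / 8) + (g / 8) ^+ 2) * (1 / 2 - t).
    by rewrite ler_wpM2r; lra.
  have : t * (g / 8) <= g / 32 * (g / 8) by rewrite ler_wpM2r//; lra.
  have : 0 <= (g / 8) ^+ 2 * t by rewrite mulr_ge0// sqr_ge0.
  lra.
- by rewrite lexx andbT; apply: addr_ge0; apply: mulr_ge0; lra.
- have : (1 / 2 + g) * b <= (1 / 2 + g) * (1 - g / 8 + (g / 8) ^+ 2).
    by rewrite ler_wpM2l//; lra.
  have : (1 / 2 + g) * (g / 8) ^+ 2 <= 1 * (g / 8) ^+ 2.
    by rewrite ler_wpM2r ?sqr_ge0//; lra.
  lra.
Qed.

Lemma sum_log_weight (k : 'I_N) : (8 <= N)%N ->
  \sum_(j < N | j != pi k) log_weight k j <= - (g ^+ 2 * N%:R / 64).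
Proof.
move=> N8; have gp := g0; have gh := g1; rewrite (reindex_inj (@perm_inj _ pi)) /=.
under eq_bigl do rewrite (inj_eq (@perm_inj _ pi)).
under eq_bigr do rewrite /log_weight posK.
have gg : 0 <= g ^+ 2 <= 1 by rewrite sqr_ge0 exprn_ile1//; lra.
have kN := ltn_ord k.
have [kK|Kk] := ltnP k K.
  have := sum_step (g ^+ 2 / 64) (- (15 * (g ^+ 2 / 64))) (ltnW kN).
  rewrite (bigD1 k)//= ltnn natrB ?(ltnW kN)// => h.
  (* Without the term of the updating sensor itself, which is -15, the sum is (16 k - 15 N + 15)
     g^2/64. *)
  have nat_ineq : (16 * k + 15 <= 14 * N)%N by rewrite /K in kK; lia.
  have : (16 * k%:R + 15 <= 14 * N%:R :> R) by rewrite -!natrM -natrD ler_nat.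
  move: h; set S := \sum_(_ < _ | _) _; move: S (k%:R : R) (N%:R : R) => S x y.
  move/andP: gg => [h0 h1]; move: (g ^+ 2) h0 h1 => z; nra.
have KN : (K <= N)%N by rewrite leq_subr.
have := sum_step (- (1 / 2)) (1 : R) KN.
rewrite (bigD1 k)//= ltnNge Kk /= (natrB _ KN) => h.
have nat_ineq : (3 * N <= 4 * K)%N by rewrite /K; lia.
have : (3 * N%:R <= 4 * K%:R :> R) by rewrite -!natrM ler_nat.
move: h; set S := \sum_(_ < _ | _) _.
move: S (K%:R : R) (N%:R : R) (ler0n R N) => S x y y0.
move/andP: gg => [h0 h1]; move: (g ^+ 2) h0 h1 => z; nra.
Qed.

End exponents.

(** * Integration of the union bound over the positions *)

Section assembly.
Variables (R : realType) (d : nat).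
Notation RP := (@mplots _ (measurableTypeR R)).
Notation VP n := (@vplots n R RP).
Notation PP n := (@vplots n ('I_d -> R) (VP d)).

(* F is not assumed measurable: pint F is then an iterated lower integral,
   bounded below through the measurable function max (W - W B) 0. *)
Lemma unif_ball_expect_ge N (F B : ('I_N -> 'I_d -> R) -> R) (delta : R) :
  (0 < d)%N -> (forall x, 0 <= F x) -> (forall x, 0 <= B x) -> rmeas (PP N) B ->
  (forall x, 1 - B x <= F x) ->
  (pint (fun x => ((\prod_(k < N) ball_ind (x k)) * B x)%:E) <=
   (fine (ball_vol R d) ^+ N * delta)%:E)%E ->
  ((1 - delta)%:E <= unif_ball_expect F)%E.
Proof.
move=> d0 F0 B0 mB BF hB; have [V0 VE] := ball_vol_fin R d0.
rewrite /unif_ball_expect; set V := fine (ball_vol R d) in V0 VE hB *.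
pose W (x : 'I_N -> 'I_d -> R) : R := \prod_(k < N) ball_ind (x k).
have W0 x : 0 <= W x by apply: prodr_ge0 => k _; exact: ball_ind_ge0.
have mW : rmeas (PP N) W by exact: rmeas_prod_ball.
pose T x := W x * B x.
have T0 x : 0 <= T x by exact: mulr_ge0.
have mT : rmeas (PP N) T by exact: rmeasM.
pose G x := if W x <= T x then 0 else W x - T x.
have G0 x : 0 <= G x by rewrite /G; case: (leP (W x) (T x)) => // /ltW; rewrite subr_ge0.
have mG : rmeas (PP N) G.
  apply: (@rmeas_if_le R _ (PP N) W T (fun=> 0) (fun x => W x - T x)) => //.
  exact: rmeasB.
have opP := @iop_pint R d N.
have GF : (pint (fun x => (G x)%:E) <= pint (fun x => (W x * F x)%:E))%E.
  apply: (iop_le opP) => x; rewrite lee_fin// /G.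
  case: (leP (W x) (T x)) => _; first exact: mulr_ge0.
  rewrite /T -[X in X - _]mulr1 -mulrBr; exact: ler_wpM2l.
have : (pint (fun x => (W x)%:E) <= pint (fun x => (G x)%:E) + pint (fun x => (T x)%:E))%E.
  rewrite -(iopD opP)//; try exact: rmeas_EFin.
  - apply: (iop_le opP) => x; rewrite ?lee_fin// /G.
    by case: (leP (W x) (T x)) => h; [rewrite add0r|rewrite subrK].
rewrite /W (pint_ball R d0) -/V => h.
rewrite lee_pdivlMl ?exprn_gt0//.
have : ((V ^+ N)%:E <= pint (fun x => (W x * F x)%:E) + (V ^+ N * delta)%:E)%E.
  by apply: le_trans h _; apply: leeD.
rewrite -leeBlDr// -EFinB; apply: le_trans.
by rewrite -EFinM lee_fin mulrBr mulr1.
Qed.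

Lemma prob_good_ge N (w : 'I_d -> R) (g delta r : R)
    (q : ('I_N -> 'I_d -> R) -> 'I_N -> R) (tb : tie_rule R d N) :
  (0 < d)%N -> dotp w w = 1 -> 0 < g -> g <= 1 / 2 -> 0 < r ->
  r * Num.sqrt d%:R <= 1 / 32 -> 43 * (r * Num.sqrt d%:R) <= g / 32 ->
  (forall x i, 0 <= q x i <= 1 / 2 - g) -> (8 <= N)%N ->
  N%:R * expR (- ((r / 2) ^+ d * (g ^+ 2 * N%:R / 64))) <= delta ->
  ((1 - delta)%:E <= prob_good w r q tb)%E.
Proof.
move=> d0 w1 g0 g1 r0 rs rs43 hq N8 hdelta.
have [V0 VE] := ball_vol_fin R d0.
case: N => [//|n] in q tb hq N8 hdelta *.
set K := (n.+1 - n.+1 %/ 4)%N.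
have t0 : 0 <= 43 * (r * Num.sqrt d%:R) by rewrite !mulr_ge0 ?sqrtr_ge0 ?ltW.
pose pw (p : {perm 'I_n.+1} * 'I_n.+1) x :=
  pair_weight w r (p.1 p.2) (weight_bad p.1 K (1 / 2 - g) (tilt g) p.2)
    (weight_good p.1 K (1 / 2 - g) (tilt g) p.2) x.
have pw0 p x : 0 <= pw p x.
  by apply: pair_weight_ge0 => j; exact: (weight_log_weight p.1 g0 g1 p.2 j t0 rs43).1.
have F0 : 0 < (n.+1)`!%:R :> R by rewrite ltr0n fact_gt0.
pose B x := \sum_p (n.+1)`!%:R^-1 * pw p x.
have eta1 : 1 / 2 - g <= 1 by lra.
have eta0 : 0 <= 1 / 2 - g by lra.
apply: (@unif_ball_expect_ge _ _ B) => //.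
- move=> x; apply: sumr_ge0 => s _; apply: mulr_ge0.
    exact: (init_prob_ge0 w x (hq x) eta1).
  by rewrite divr_ge0 ?ler0n// sumr_ge0.
- by move=> x; apply: sumr_ge0 => p _; rewrite mulr_ge0 ?invr_ge0 ?ler0n.
- move=> e Z b pb; apply: measurable_sum => p; apply: measurable_funM => //.
  exact: (rmeas_pair_weight w r0 _ _ _ pb).
- by move=> x; apply: cond_prob_good_ge => //; exact: tilt_ge1.
have mpw p : meas_on (PP n.+1) (fun x => ((\prod_k ball_ind (x k)) * pw p x)%:E).
  apply: (@rmeas_EFin R _ (PP n.+1) (fun x => (\prod_k ball_ind (x k)) * pw p x)).
  by apply: rmeasM; [exact: rmeas_prod_ball|exact: rmeas_pair_weight].
have W0 x : 0 <= \prod_(k < n.+1) ball_ind (x k) :> R.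
  by apply: prodr_ge0 => k _; exact: ball_ind_ge0.
pose f (p : {perm 'I_n.+1} * 'I_n.+1) x : R :=
  (n.+1)`!%:R^-1 * ((\prod_k ball_ind (x k)) * pw p x).
have -> : (fun x => ((\prod_k ball_ind (x k)) * B x)%:E) = (fun x => (\sum_p f p x)%:E).
  apply/funext => x; congr EFin; rewrite /B mulr_sumr.
  by apply: eq_bigr => p _; rewrite mulrCA.
rewrite (iop_sum _ (iop_pint R d n.+1)); first last.
- move=> p; apply: (@rmeas_EFin R _ (PP n.+1) (f p)); apply: rmeasM.
    exact: rmeas_cst.
  by apply: rmeasM; [exact: rmeas_prod_ball|exact: rmeas_pair_weight].
- by move=> p x; rewrite /f mulr_ge0 ?invr_ge0 ?ler0n// mulr_ge0.
set V := fine (ball_vol R d) in V0 VE *.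
set Bd := expR _ in hdelta.
(* All pairs of a permutation and a step get the same bound; averaging over permutations leaves one
   term per step. *)
apply: (@le_trans _ _ (\sum_(p : {perm 'I_n.+1} * 'I_n.+1)
    ((n.+1)`!%:R^-1 * (V ^+ n.+1 * Bd))%:E)%E).
  apply: lee_sum => p _.
  rewrite [X in (X <= _)%E](_ : _ = ((n.+1)`!%:R^-1)%:E *
      pint (fun x => ((\prod_k ball_ind (x k)) * pw p x)%:E))%E; last first.
    have Fi0 : 0 <= (n.+1)`!%:R^-1 :> R by rewrite invr_ge0 ler0n.
    rewrite -(iopZ (iop_pint R d n.+1) Fi0) => [|x|]; [by []| |exact: mpw].
    by rewrite lee_fin mulr_ge0.
  rewrite EFinM lee_wpmul2l ?lee_fin ?invr_ge0 ?ler0n//.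
  apply: (chernoff_integral d0 w1 r0 rs (e := log_weight p.1 g p.2)).
  - by move=> j; exact: (weight_log_weight p.1 g0 g1 p.2 j t0 rs43).1.
  - by move=> j; exact: (weight_log_weight p.1 g0 g1 p.2 j t0 rs43).2.
  - by rewrite divr_ge0// mulr_ge0 ?sqr_ge0 ?ler0n.
  - exact: sum_log_weight.
rewrite sumEFin lee_fin sumr_const card_prod card_Sn card_ord -[leLHS]mulr_natl natrM.
by rewrite mulrACA divff ?gt_eqF// mul1r mulrCA ler_pM2l ?exprn_gt0.
Qed.

End assembly.

Theorem theorem5 (R : realType) :
  exists c3 c4 : R, 0 < c3 /\ 0 < c4 /\
  forall (d : nat) (w : 'I_d -> R) (eta delta r : R) (N : nat)
         (q : ('I_N -> 'I_d -> R) -> 'I_N -> R) (tb : tie_rule R d N),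
    (1 <= d)%N ->
    norm2 w = 1 ->
    0 <= eta -> eta < 1 / 2 ->
    0 < delta -> delta < 1 ->
    0 < r ->
    r <= (1 / 2 - eta) / (c3 * Num.sqrt d%:R) ->
    c4 / ((r / 2) ^+ d * (1 / 2 - eta) ^+ 2)
      * ln (1 / (r ^+ d * (1 / 2 - eta) * delta)) <= N%:R ->
    (forall x i, 0 <= q x i <= eta) ->
    ((1 - delta)%:E <= prob_good w r q tb)%E.
Proof.
(* The first constant makes the slab excess 43 r sqrt d at most g/32, as [weight_log_weight] needs;
   the second is that of [union_bound_small]. *)
exists (32 * 43), (6 * 64); split; first by rewrite mulr_gt0.
split; first by rewrite mulr_gt0.
move=> d w eta delta r N q tb d0 w1 eta0 eta1 de0 de1 r0 hr hN hq.
set g := 1 / 2 - eta in hr hN *.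
have g0 : 0 < g by rewrite /g; lra.
have g1 : g <= 1 / 2 by rewrite /g; lra.
have s1 : 1 <= Num.sqrt d%:R :> R by rewrite -[leLHS]sqrtr1 ler_sqrt ?ler0n ?ler1n.
have rs43 : 43 * (r * Num.sqrt d%:R) <= g / 32.
  move: hr; rewrite ler_pdivlMr; last by rewrite !mulr_gt0// (lt_le_trans _ s1).
  by lra.
have rs : r * Num.sqrt d%:R <= 1 / 32 by lra.
have r1 : r <= 1 / 16.
  have : r * 1 <= r * Num.sqrt d%:R by rewrite ler_pM2l.
  by lra.
have ww : dotp w w = 1.
  by rewrite -[LHS]sqr_sqrtr ?dotp_ge0// -/(norm2 w) w1 expr1n.
have [N8 small] := union_bound_small d0 r0 r1 g0 g1 de0 de1 hN.
apply: (prob_good_ge (g := g)) => //.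
by move=> x i; rewrite /g opprB addrC subrK.
Qed.
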